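(* Let $X=(X_t)_{t\ge0}$ be a stable, non-explosive continuous-time Markov process on $\mathbb{N}=\{0,1,2,\dots\}$, conservative in $\mathbb{N}^*=\{1,2,3,\dots\}$, with $0$ absorbing and $\mathbb{P}_x(T_0<+\infty)=1$ for all $x\in\mathbb{N}$, where $T_0=\inf\{s\ge 0:\ X_s=0\}$. Let $(Q(x,y))_{x,y\in\mathbb{N}}$ be its transition rate matrix and $P_t(x,y)=\mathbb{P}_x(X_t=y)$ its transition probabilities. Assume that there exists a finite subset $K\subset \mathbb{N}^*$ such that $$\inf_{y\in \mathbb{N}^*\setminus K} \left(Q(y,0) + \sum_{x\in K} Q(y,x)\right) > \sup_{y\in \mathbb{N}^*} Q(y,0)$$ and that $P_t(x,y)>0$ for all $x,y\in K$ and all $t>0$. Then there exist a constant $\gamma\in\,]0,1[$ and a probability measure $\rho$ on $\mathbb{N}^*$ such that, for any initial distribution $\mu$ on $\mathbb{N}^*$ and all $t\geq 0$, $$\left\|\mathbb{P}_{\mu}\left(X_t\in\cdot\mid t<T_0\right)-\rho \right\|_{TV}\leq 2(1-\gamma)^{[t]}.$$ In particular, $\rho$ is the unique quasi-stationary distribution associated to $X$.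
   Context: Stable means that every state has a finite total exit rate; conservative in $\mathbb{N}^*$ means that for each $x\in\mathbb{N}^*$ the exit rate from $x$ equals $\sum_{y\in\mathbb{N}\setminus\{x\}}Q(x,y)$, i.e. $-Q(x,x)=\sum_{y\ne x}Q(x,y)<\infty$. $0$ is absorbing means $X_t=0$ for all $t\ge T_0$. The process is not assumed irreducible on $\mathbb{N}^*$, nor are its rates assumed uniformly bounded. $\mathbb{P}_x$ (resp. $\mathbb{P}_\mu$) denotes the law of the process started at $x$ (resp. with initial law $\mu$). A quasi-stationary distribution (QSD) for $X$ is a probability measure $\rho$ on $\mathbb{N}^*$ such that $\rho(\cdot)=\mathbb{P}_\rho(X_t\in\cdot\mid t<T_0)$ for all $t\ge 0$. $\|\cdot\|_{TV}$ is the total variation norm for signed measures on $\mathbb{N}^*$, $\|\nu\|_{TV}=|\nu|(\mathbb{N}^* )=\sum_{x\in\mathbb{N}^*}|\nu(\{x\})|$ (so two mutually singular probability measures are at distance $2$). $[t]$ is the integer part of $t$. *)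

(* Defs.v *)
From mathcomp Require Import all_boot all_order all_algebra.
From mathcomp Require Import finmap.
From mathcomp Require Import all_classical all_reals all_analysis.

Set Implicit Arguments.
Unset Strict Implicit.
Unset Printing Implicit Defensive.
Import Order.TTheory GRing.Theory Num.Theory.
Import numFieldNormedType.Exports.

Local Open Scope classical_set_scope.
Local Open Scope ring_scope.

(* A process with values in nat is X : R -> Omega -> nat; only times t >= 0
   are meaningful.  P x is the law of the process started at x.  A measure on
   N* = {1, 2, ...} is a measure on nat giving mass 0 to [set 0]. *)

Definition right_continuous_path (R : realType) (f : R -> nat) : Prop :=
  forall t : R, 0 <= t -> \forall s \near t^'+, f s = f t.

(* For a right-continuous f with values in a discrete space, the
   discontinuities are exactly the t > 0 at which f differs from f t at
   times arbitrarily close to t on the left. *)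
Definition jump_times (R : realType) (f : R -> nat) : set R :=
  [set t | 0 < t /\ ~ (\forall s \near t^'-, f s = f t)].

Definition past (R : realType) d (Omega : measurableType d)
    (X : R -> Omega -> nat) (t : R) : set (set Omega) :=
  <<s [set A | exists u : R, exists B : set nat,
         0 <= u <= t /\ A = X u @^-1` B] >>.

Record markov_process (R : realType) d (Omega : measurableType d)
    (P : nat -> probability Omega R) (X : R -> Omega -> nat) : Prop :=
  MarkovProcess {
    mp_measurable : forall t : R, 0 <= t -> measurable_fun setT (X t);
    mp_right_continuous : forall w : Omega, right_continuous_path (X^~ w);
    mp_start : forall x : nat, P x (X 0 @^-1` [set x]) = 1%E;
    mp_markov : forall (x y z : nat) (t s : R) (A : set Omega),
      0 <= t -> 0 <= s -> past X t A ->
      P x (A `&` X t @^-1` [set y] `&` X (t + s) @^-1` [set z]) =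
      (P x (A `&` X t @^-1` [set y]) * P y (X s @^-1` [set z]))%E
  }.

Definition nonexplosive (R : realType) d (Omega : measurableType d)
    (P : nat -> probability Omega R) (X : R -> Omega -> nat) : Prop :=
  forall x : nat, {ae P x, forall w,
    forall T : R, finite_set (jump_times (X^~ w) `&` [set t | t <= T])}.

Definition transition (R : realType) d (Omega : measurableType d)
    (P : nat -> probability Omega R) (X : R -> Omega -> nat)
    (t : R) (x y : nat) : R :=
  fine (P x (X t @^-1` [set y])).

(* Since Q takes values in R, the exit rates - Q x x are finite, i.e. the
   process is stable. *)
Definition stable_with_rates (R : realType) d (Omega : measurableType d)
    (P : nat -> probability Omega R) (X : R -> Omega -> nat)
    (Q : nat -> nat -> R) : Prop :=
  forall x y : nat,
    (transition P X t x y - (x == y)%:R) / t @[t --> 0^'+] --> Q x y.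

Definition conservative_on_Nstar (R : realType) (Q : nat -> nat -> R) : Prop :=
  forall x : nat, (0 < x)%N ->
    (\sum_(0 <= y <oo | y != x) (Q x y)%:E = (- Q x x)%:E)%E.

Definition T0 (R : realType) (Omega : Type) (X : R -> Omega -> nat)
    (w : Omega) : \bar R :=
  ereal_inf [set s%:E | s in [set s : R | 0 <= s /\ X s w = 0%N]].

Definition zero_absorbing (R : realType) (Omega : Type)
    (X : R -> Omega -> nat) : Prop :=
  forall (w : Omega) (t : R), 0 <= t -> (T0 X w <= t%:E)%E -> X t w = 0%N.

Definition initial_law (R : realType) d (Omega : measurableType d)
    (P : nat -> probability Omega R) (mu : probability nat R)
    (A : set Omega) : \bar R :=
  (\sum_(0 <= x <oo) mu [set x] * P x A)%E.

Definition conditioned_law (R : realType) d (Omega : measurableType d)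
    (P : nat -> probability Omega R) (X : R -> Omega -> nat)
    (mu : probability nat R) (t : R) (B : set nat) : R :=
  fine (initial_law P mu (X t @^-1` B `&` [set w | (t%:E < T0 X w)%E])) /
  fine (initial_law P mu [set w | (t%:E < T0 X w)%E]).

(* Total variation norm on N*, with the normalization under which mutually
   singular probability measures are at distance 2. *)
Definition tv_norm (R : realType) (nu : set nat -> R) : \bar R :=
  (\sum_(1 <= x <oo) `|nu [set x]|%:E)%E.

Definition quasi_stationary (R : realType) d (Omega : measurableType d)
    (P : nat -> probability Omega R) (X : R -> Omega -> nat)
    (rho : probability nat R) : Prop :=
  rho [set 0%N] = 0%E /\
  forall (t : R) (B : set nat), 0 <= t ->
    rho B = (conditioned_law P X rho t B)%:E.

(* Main.v *)
Require Import Defs.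
From mathcomp Require Import all_boot all_order all_algebra.
From mathcomp Require Import finmap.
From mathcomp Require Import all_classical all_reals all_analysis.
From mathcomp Require Import lra ring.

Set Implicit Arguments.
Unset Strict Implicit.
Unset Printing Implicit Defensive.
Import Order.TTheory GRing.Theory Num.Theory.
Import numFieldNormedType.Exports.

Local Open Scope classical_set_scope.
Local Open Scope ring_scope.

(** Write u(t, x) for the probability of survival up to time t from x, and
    p(t, x, y) for the transition probabilities.  The strict inequality between
    the infimum and the supremum leaves room for two reals 0 < a < b such that
    every state of N* is killed at a rate below a, while every state outside K
    moves to K or to 0 at a rate above b.  Fix z in K.  Two estimates follow:
    from every x >= 1 one has p(1, x, z) >= c > 0 ([minorization]), because
    returning to K beats being killed; and u(t, x) <= C u(t, z) for all t and x
    ([survival_compare]), because survival from z decays at rate at most a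
    whereas the chance of avoiding K decays at rate b.

    Given these two estimates the convergence is a contraction argument.  Means
    of f(X_(1 + t)) conditioned on survival are weighted averages of the means
    of f(X_t) conditioned on survival, in which z has weight at least
    gamma = c / (2 C), so each unit of time shrinks their range by 1 - gamma
    ([cond_means_in_step]).  The ranges at all times close in on one number,
    [limit_mean f]; these numbers are the means of a probability measure
    ([limit_law]), it is quasi-stationary because the Markov property passes to
    the limit ([limit_mean_ts]), and all conditioned laws converge to it, which
    also gives uniqueness.

    The two estimates are comparison results for functions on an infinite state
    space with unbounded rates.  They rest on [maximum_principle], which
    replaces hitting times and jump chains: the skeleton chain of small mesh h,
    killed outside {0, ..., N - 1}, loses little mass when N is large, uniformly
    in h ([process_confined]), because without explosion a path has finitely
    many jumps, hence is bounded, on a bounded time interval; and on a finite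
    set the asymptotics of p(h, x, y) as h tends to 0 are uniform in x.  Only
    the Markov property at fixed times is involved. *)

(** * Bounded functions and expectations of integer-valued variables *)

Definition bnd (R : realType) (f : nat -> R) : Prop :=
  exists M, forall x, `|f x| <= M.

Section Bounded.
Variable R : realType.
Implicit Types f g : nat -> R.

Lemma bnd_cst (c : R) : bnd (fun=> c).
Proof. by exists `|c|. Qed.

Lemma bndD f g : bnd f -> bnd g -> bnd (fun x => f x + g x).
Proof.
move=> [M hM] [N hN]; exists (M + N) => x.
by rewrite (le_trans (ler_normD _ _))// lerD.
Qed.

Lemma bndZ (c : R) f : bnd f -> bnd (fun x => c * f x).
Proof.
by move=> [M hM]; exists (`|c| * M) => x; rewrite normrM ler_wpM2l.
Qed.

Lemma bndB f g : bnd f -> bnd g -> bnd (fun x => f x - g x).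
Proof.
move=> bf /(bndZ (-1)) bg; have := bndD bf bg.
by congr bnd; apply/funext => x; rewrite mulN1r.
Qed.

Lemma bnd_le f (a b : R) : (forall x, a <= f x <= b) -> bnd f.
Proof.
move=> h; exists (`|a| + `|b|) => x; have /andP[h1 h2] := h x.
have := ler_norm b; have := ler_norm (- a); rewrite normrN ler_norml.
by have := normr_ge0 a; have := normr_ge0 b => *; apply/andP; split; lra.
Qed.

Lemma bnd_sum (I : Type) (s : seq I) (F : I -> nat -> R) :
  (forall i, bnd (F i)) -> bnd (fun x => \sum_(i <- s) F i x).
Proof.
move=> bF; elim: s => [|i s IH].
  by have := bnd_cst 0; congr bnd; apply/funext => x; rewrite big_nil.
have := bndD (bF i) IH.
by congr bnd; apply/funext => x; rewrite big_cons.
Qed.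

End Bounded.

Section Expectation.
Context (R : realType) d (Omega : measurableType d) (P : probability Omega R).
Variable Y : Omega -> nat.
Hypothesis mY : measurable_fun setT Y.
Implicit Types f g : nat -> R.

Definition expect f : R := \int[P]_w f (Y w).

Lemma measurable_natfun d' (U : measurableType d') (f : nat -> U) :
  measurable_fun setT (f \o Y).
Proof. exact: measurableT_comp. Qed.

Lemma measurable_preim_nat (B : set nat) : measurable (Y @^-1` B).
Proof. by rewrite -[X in measurable X]setTI; exact: mY. Qed.

Lemma bnd_integrable f : bnd f -> P.-integrable setT (EFin \o (f \o Y)).
Proof.
move=> [M hM]; apply: measurable_bounded_integrable => //.
- by rewrite (le_lt_trans (probability_le1 P measurableT))// ltry.
- exact: measurable_natfun.
- exists M; split; first exact: num_real.
  by move=> x Mx w _; exact: le_trans (hM _) (ltW Mx).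
Qed.

Lemma expectD f g : bnd f -> bnd g ->
  expect (fun x => f x + g x) = expect f + expect g.
Proof.
by move=> bf bg; rewrite /expect RintegralD//; exact: bnd_integrable.
Qed.

Lemma expectZ c f : bnd f -> expect (fun x => c * f x) = c * expect f.
Proof.
by move=> bf; rewrite /expect RintegralZl//; exact: bnd_integrable.
Qed.

Lemma expect_cst c : expect (fun=> c) = c.
Proof.
rewrite /expect Rintegral_cst// -[RHS]mulr1; congr (_ * _).
exact: (congr1 fine (probability_setT P)).
Qed.

Lemma expect_ge0 f : (forall x, 0 <= f x) -> 0 <= expect f.
Proof. by move=> f0; apply: Rintegral_ge0. Qed.

Lemma expect_indic (B : set nat) :
  expect \1_B = fine (P (Y @^-1` B)).
Proof.
rewrite /expect /Rintegral; congr fine.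
rewrite (_ : (fun _ => _) = fun w => (\1_(Y @^-1` B) w)%:E).
  by rewrite integral_indic ?setIT//; exact: measurable_preim_nat.
by apply/funext => w; rewrite !indicE; congr (_%:R%:E).
Qed.

Lemma expectE f : bnd f -> (expect f)%:E = (\int[P]_w (f (Y w))%:E)%E.
Proof.
move=> bf; rewrite /expect /Rintegral fineK//.
exact/integrable_fin_num/bnd_integrable.
Qed.

(** Countable additivity enters through this formula: the law of [Y] is carried
    by atoms, so that manipulations of expectations become manipulations of
    series with nonnegative terms. *)
Lemma expect_series f : bnd f -> (forall x, 0 <= f x) ->
  (expect f)%:E = (\sum_(0 <= x <oo) P (Y @^-1` [set x]) * (f x)%:E)%E.
Proof.
move=> bf f0; rewrite expectE//.
have -> : [set: Omega] = \bigcup_x (Y @^-1` [set x]).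
  by apply/seteqP; split => // w _; exists (Y w).
rewrite ge0_integral_bigcup//=; last 4 first.
- by move=> k; exact: measurable_preim_nat.
- apply/measurable_realfun.measurable_EFinP.
  apply: (@measurable_funS _ _ Omega R setT _ (f \o Y) measurableT) => //.
  exact: (measurable_natfun f).
- by move=> w _; rewrite lee_fin.
- by move=> i j _ _ [w [/= <- <-]].
apply: eq_eseriesr => x _.
transitivity (\int[P]_(w in Y @^-1` [set x]) cst (f x)%:E w)%E.
  by apply: eq_integral => w; rewrite inE => /= ->.
by rewrite integral_cst; [rewrite muleC | exact: measurable_preim_nat].
Qed.

End Expectation.

Lemma expect_le (R : realType) d (Omega : measurableType d)
    (P : probability Omega R) (Y : Omega -> nat) (f g : nat -> R) :
  measurable_fun setT Y -> bnd f -> bnd g -> (forall x, f x <= g x) ->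
  expect P Y f <= expect P Y g.
Proof.
move=> mY bf bg fg; apply: le_Rintegral => //; exact: bnd_integrable.
Qed.

Lemma expect_sum (R : realType) d (Omega : measurableType d)
    (P : probability Omega R) (Y : Omega -> nat) (I : Type) (s : seq I)
    (F : I -> nat -> R) :
  measurable_fun setT Y -> (forall i, bnd (F i)) ->
  expect P Y (fun y => \sum_(i <- s) F i y) = \sum_(i <- s) expect P Y (F i).
Proof.
move=> mY bF; elim: s => [|i s IH].
  rewrite big_nil -[RHS](expect_cst P Y 0); congr (expect P Y _).
  by apply/funext => y; rewrite big_nil.
rewrite big_cons -IH -(expectD _ mY)//; last exact: bnd_sum.
by congr (expect P Y _); apply/funext => y; rewrite big_cons.
Qed.

Lemma measurable_id_nat : measurable_fun setT (id : nat -> nat).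
Proof. exact: measurable_id. Qed.

Lemma probabilityD0 (R : realType) (mu : probability nat R) (B : set nat) :
  mu [set 0%N] = 0%E -> mu (B `\` [set 0%N]) = mu B.
Proof.
move=> mu0; rewrite [RHS](measureDI mu (B := [set 0%N]))// -[LHS]adde0.
congr (_ + _)%E; apply/esym/(subset_measure0 _ _ (@subIsetr _ B [set 0%N])) => //.
Qed.

Lemma expect_not0 (R : realType) (mu : probability nat R) :
  mu [set 0%N] = 0%E -> expect mu id \1_(~` [set 0%N]) = 1.
Proof.
move=> mu0; rewrite (expect_indic _ measurable_id_nat) preimage_id.
by rewrite -setTD probabilityD0// probability_setT.
Qed.

(** * Transition semigroups and a maximum principle *)

(** [T t f x] stands for the mean of [f] at time [t] from [x].  Letting the
    semigroup act on bounded functions, rather than on measures, keeps all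
    estimates inside the real numbers. *)
Record transition_semigroup (R : realType)
    (T : R -> (nat -> R) -> nat -> R) : Prop := TransitionSemigroup {
  tsD : forall t f g x, 0 <= t -> bnd f -> bnd g ->
    T t (fun y => f y + g y) x = T t f x + T t g x;
  tsZ : forall t c f x, 0 <= t -> bnd f ->
    T t (fun y => c * f y) x = c * T t f x;
  ts_cst : forall t c x, 0 <= t -> T t (fun=> c) x = c;
  ts_ge0 : forall t f x, 0 <= t -> bnd f -> (forall y, 0 <= f y) ->
    0 <= T t f x;
  ts_start : forall f x, bnd f -> T 0 f x = f x;
  ts_comp : forall s t f x, 0 <= s -> 0 <= t -> bnd f ->
    T (s + t) f x = T s (T t f) x }.

Lemma near_right0 (R : realType) (A : R -> Prop) :
  (\forall h \near 0^'+, A h) ->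
  exists2 e : R, 0 < e & forall h, 0 < h < e -> A h.
Proof.
move=> [e /= e0 he]; exists e => // h /andP[h0 hh].
by apply: he => //=; rewrite sub0r normrN gtr0_norm.
Qed.

Definition trans_prob (R : realType) (T : R -> (nat -> R) -> nat -> R)
  (t : R) (x y : nat) : R := T t \1_[set y] x.

(** One step of the skeleton chain of mesh [h] killed outside
    {0, ..., N - 1}. *)
Definition killed (R : realType) (T : R -> (nat -> R) -> nat -> R)
    (N : nat) (h : R) (f : nat -> R) (x : nat) : R :=
  if (x < N)%N then \sum_(y < N) trans_prob T h x y * f y else 0.

Section Semigroup.
Context (R : realType) (T : R -> (nat -> R) -> nat -> R).
Hypothesis sgT : transition_semigroup T.
Implicit Types (f g : nat -> R) (t h : R) (x y z : nat).
Local Notation p := (trans_prob T).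

Lemma tsB t f g x : 0 <= t -> bnd f -> bnd g ->
  T t (fun y => f y - g y) x = T t f x - T t g x.
Proof.
move=> t0 bf bg; rewrite -(mulN1r (T t g x)) -(tsZ sgT)// -(tsD sgT)//.
  by congr T; apply/funext => y; rewrite mulN1r.
exact: bndZ.
Qed.

Lemma ts_le t f g x : 0 <= t -> bnd f -> bnd g -> (forall y, f y <= g y) ->
  T t f x <= T t g x.
Proof.
move=> t0 bf bg fg; rewrite -subr_ge0 -tsB//; apply: (ts_ge0 sgT) => //.
  exact: bndB.
by move=> y; rewrite subr_ge0.
Qed.

Lemma ts_itv t f x (a b : R) : 0 <= t -> (forall y, a <= f y <= b) ->
  a <= T t f x <= b.
Proof.
move=> t0 fab; have bf : bnd f := bnd_le fab.
rewrite -[X in X <= _ <= _](ts_cst sgT a x t0).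
rewrite -[X in _ <= _ <= X](ts_cst sgT b x t0).
by rewrite !ts_le//; try exact: bnd_cst; move=> y; have /andP[] := fab y.
Qed.

Lemma ts_bnd t f : 0 <= t -> bnd f -> bnd (T t f).
Proof.
move=> t0 [M fM]; apply: (@bnd_le _ _ (- M) M) => x; apply: ts_itv => // y.
by rewrite -ler_norml.
Qed.

Lemma ts_sum t (I : Type) (s : seq I) (F : I -> nat -> R) x : 0 <= t ->
  (forall i, bnd (F i)) ->
  T t (fun y => \sum_(i <- s) F i y) x = \sum_(i <- s) T t (F i) x.
Proof.
move=> t0 bF; elim: s => [|i s IH].
  rewrite big_nil -[RHS](ts_cst sgT 0 x t0); congr T.
  by apply/funext => y; rewrite big_nil.
rewrite big_cons -IH -(tsD sgT)//; last exact: bnd_sum.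
by congr T; apply/funext => y; rewrite big_cons.
Qed.

Lemma indic_itv (A : set nat) y : 0 <= (\1_A y : R) <= 1.
Proof. by rewrite indicE; case: (_ \in _); rewrite /= ?lexx ler01. Qed.

Lemma bnd_indic (A : set nat) : bnd (\1_A : nat -> R).
Proof. exact: bnd_le (indic_itv A). Qed.

Lemma indic1E (x y : nat) : \1_[set x] y = (y == x)%:R :> R.
Proof. by rewrite indicE in_set1. Qed.

Lemma trans_prob_itv t x y : 0 <= t -> 0 <= p t x y <= 1.
Proof. by move=> t0; apply: ts_itv => // z; exact: indic_itv. Qed.

Lemma trans_prob_ge0 t x y : 0 <= t -> 0 <= p t x y.
Proof. by move=> t0; have /andP[] := trans_prob_itv x y t0. Qed.

Lemma sum_trans_prob_le t f x (s : seq nat) : 0 <= t -> bnd f ->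
  (forall y, 0 <= f y) -> uniq s -> \sum_(y <- s) p t x y * f y <= T t f x.
Proof.
move=> t0 bf f0 us.
have bF y : bnd (fun z => f y * (\1_[set y] z : R)) by exact/bndZ/bnd_indic.
have -> : \sum_(y <- s) p t x y * f y =
    T t (fun z => \sum_(y <- s) f y * \1_[set y] z) x.
  rewrite ts_sum//; apply: eq_bigr => y _.
  by rewrite (tsZ sgT _ _ t0 (bnd_indic [set y])) mulrC /trans_prob.
apply: ts_le => //; first exact: bnd_sum.
move=> z; under eq_bigr do rewrite indic1E.
have [zs|zs] := boolP (z \in s).
  rewrite (bigD1_seq z)//= eqxx mulr1 big1_seq ?addr0// => y /andP[yz _].
  by rewrite eq_sym (negbTE yz) mulr0.
rewrite big1_seq// => y /= ys; case: eqVneq => [zy|]; last by rewrite mulr0.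
by move: zs; rewrite zy ys.
Qed.

Lemma killed_ts N h f x : 0 <= h -> bnd f -> (forall y, 0 <= f y) ->
  killed T N h f x <= T h f x.
Proof.
move=> h0 bf f0; rewrite /killed; case: ifP => _; last exact: (ts_ge0 sgT).
rewrite -(big_mkord xpredT (fun y => p h x y * f y)).
by apply: sum_trans_prob_le => //; exact: iota_uniq.
Qed.

Lemma killed_le N h f g x : 0 <= h -> (forall y, f y <= g y) ->
  killed T N h f x <= killed T N h g x.
Proof.
move=> h0 fg; rewrite /killed; case: ifP => // _; apply: ler_sum => y _.
by rewrite ler_wpM2l// trans_prob_ge0.
Qed.

Lemma iter_killed_ts N h f n x : 0 <= h -> bnd f -> (forall y, 0 <= f y) ->
  iter n (killed T N h) f x <= T (n%:R * h) f x.
Proof.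
move=> h0 bf f0; elim: n x => [|n IH] x /=.
  by rewrite mul0r (ts_start sgT).
have nh0 : 0 <= n%:R * h by rewrite mulr_ge0.
rewrite (le_trans (killed_le _ _ h0 IH))// mulrSr mulrDl mul1r addrC.
rewrite (ts_comp sgT)//; apply: killed_ts => //; first exact: ts_bnd.
by move=> y; exact: (ts_ge0 sgT).
Qed.

Lemma iter_killedB N h (M : R) f n x :
  iter n (killed T N h) (fun y => M - f y) x =
  M * iter n (killed T N h) (fun=> 1) x - iter n (killed T N h) f x.
Proof.
elim: n x => [|n IH] x /=; first by rewrite mulr1.
rewrite (funext IH) /killed; case: ifP => _; last by rewrite mulr0 subr0.
rewrite mulr_sumr -sumrB; apply: eq_bigr => y _; ring.
Qed.

(** Killing discards a positive operator, whose norm is read off on the constant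
    function 1; the domination of killed iterates, applied to [M - f], bounds
    what it discards from [f]. *)
Lemma ts_le_iter_killed N h (M : R) f n x : 0 <= h ->
  (forall y, 0 <= f y <= M) ->
  T (n%:R * h) f x <= M * (1 - iter n (killed T N h) (fun=> 1) x)
                      + iter n (killed T N h) f x.
Proof.
move=> h0 fM; have bf := bnd_le fM.
have bMf : bnd (fun y => M - f y) by apply: bndB => //; exact: bnd_cst.
have : iter n (killed T N h) (fun y => M - f y) x <=
       T (n%:R * h) (fun y => M - f y) x.
  apply: iter_killed_ts => // y; rewrite subr_ge0.
  by have /andP[] := fM y.
have nh0 : 0 <= n%:R * h by rewrite mulr_ge0.
rewrite tsB//; last exact: bnd_cst.
rewrite (ts_cst sgT)// iter_killedB.
set a := iter _ _ _ _; set b := iter _ _ _ _; set c := T _ _ _; nra.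
Qed.

(** The form in which non-explosion is used.  As [N] does not depend on [n], the
    mesh can be sent to 0 after the finite set has been fixed. *)
Definition confined := forall x t (eta : R), 0 < t -> 0 < eta ->
  exists N, forall n, (0 < n)%N ->
    1 - eta <= iter n (killed T N (t / n%:R)) (fun=> 1) x.

Hypothesis cT : confined.

(** A supersolution [v] of the one-step inequality dominates the mean of [f].
    The inequality is only asked on a finite set, where estimates for small [h]
    are uniform; [confined] pays for the rest.  The second alternative is what
    replaces stopping the process: at a state where the mean of [f] is already
    known to be below [v], such as 0 or a state of [K], no inequality on the step
    of [v] is asked. *)
Lemma maximum_principle t f (M : R) x (c : R) : 0 < t ->
  (forall y, 0 <= f y <= M) ->
  (forall N, \forall h \near 0^'+, forall n, n%:R * h = t ->
    exists v : nat -> nat -> R,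
      [/\ forall j, bnd (v j) /\ ((j <= n)%N -> forall y, 0 <= v j y),
          forall y, f y <= v 0%N y,
          forall j y, (j < n)%N -> (y < N)%N ->
            T h (v j) y <= v j.+1 y \/ T (j.+1%:R * h) f y <= v j.+1 y
        & v n x <= c]) ->
  T t f x <= c.
Proof.
move=> t0 fM super; have bf := bnd_le fM.
have f0 y : 0 <= f y by have /andP[] := fM y.
have M0 : 0 <= M by have /andP[h1 h2] := fM 0%N; exact: le_trans h2.
apply/ler_addgt0Pr => eps eps0.
(* [M + 1] rather than [M], which may be 0 *)
have [|N hN] := cT x t0 (_ : 0 < eps / (M + 1)).
  by rewrite divr_gt0// ltr_wpDl.
have [e e0 he] := near_right0 (super N).
pose n := (Num.truncn (t / e)).+1.
have n0 : (0 : R) < n%:R by rewrite ltr0n.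
have te : t / n%:R < e.
  rewrite ltr_pdivrMr// mulrC -ltr_pdivrMr//.
  by rewrite truncnS_gt.
have h0 : 0 < t / n%:R by rewrite divr_gt0.
have nt : n%:R * (t / n%:R) = t by rewrite mulrC divfK// gt_eqF.
have [|v [bv fv sv vc]] := he (t / n%:R) _ n nt; first by rewrite h0 te.
have itv j y : (j <= n)%N -> iter j (killed T N (t / n%:R)) f y <= v j y.
  elim: j y => [|j IH] y jn //.
  have [yN|yN] := boolP (y < N)%N; last first.
    by rewrite iterS /killed (negbTE yN) (bv j.+1).2.
  have [le|le] := sv j y jn yN; last first.
    by rewrite (le_trans _ le)// iter_killed_ts// ltW.
  rewrite iterS (le_trans _ le)//.
  rewrite (le_trans (killed_le _ _ (ltW h0) (fun y => IH y (ltnW jn))))//.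
  apply: killed_ts; [exact: ltW|exact: (bv j).1|].
  by apply: (bv j).2; exact: ltnW.
rewrite -nt (le_trans (ts_le_iter_killed N n x (ltW h0) fM))//.
rewrite addrC lerD//; first exact: le_trans (itv n x (leqnn n)) vc.
rewrite (@le_trans _ _ (M * (eps / (M + 1))))//.
  by rewrite ler_wpM2l// lerBlDr -lerBlDl hN.
rewrite mulrCA ger_pMr// ler_pdivrMr ?ltr_wpDl//.
by rewrite mul1r lerDl.
Qed.

End Semigroup.

(** * Estimates from the gap between killing and return rates *)

Lemma near_forall_ltn (R : realType) (A : nat -> R -> Prop) N :
  (forall y, \forall h \near 0^'+, A y h) ->
  \forall h \near (0 : R)^'+, forall y, (y < N)%N -> A y h.
Proof.
move=> nA; have : \forall h \near (0 : R)^'+, forall i : 'I_N, A i h.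
  exact: filter_forall.
by apply: filterS => h hA y yN; exact: (hA (Ordinal yN)).
Qed.

Lemma seq_lower_bound (R : realType) (s : seq nat) (F : nat -> R) :
  (forall y, y \in s -> 0 < F y) ->
  exists c, 0 < c <= 1 /\ forall y, y \in s -> c <= F y.
Proof.
elim: s => [|x s IH] F0; first by exists 1; rewrite ltr01 lexx.
have [|c [/andP[c0 c1] hc]] := IH.
  by move=> y ys; apply: F0; rewrite in_cons ys orbT.
have Fx : 0 < F x by apply: F0; rewrite mem_head.
exists (Num.min c (F x)); split; first by rewrite lt_min c0 Fx ge_min c1.
move=> y; rewrite in_cons => /predU1P[->|/hc cy].
  by rewrite ge_min lexx orbT.
by rewrite ge_min cy.
Qed.

Definition survival (R : realType) (T : R -> (nat -> R) -> nat -> R)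
  (t : R) (x : nat) : R := T t \1_(~` [set 0%N]) x.

Section Rates.
Context (R : realType) (T : R -> (nat -> R) -> nat -> R).
Hypothesis sgT : transition_semigroup T.
Hypothesis cT : confined T.
Local Notation p := (trans_prob T).
Local Notation u := (survival T).
Hypothesis p00 : forall t, 0 <= t -> p t 0 0 = 1.
Variable K : seq nat.
Hypothesis uniqK : uniq K.
Hypothesis K0 : 0%N \notin K.
Variables a b : R.
Hypothesis a0 : 0 < a.
Hypothesis ab : a < b.
Hypothesis rate_kill : forall y, (0 < y)%N ->
  \forall h \near 0^'+, p h y 0 <= h * a.
Hypothesis rate_return : forall y, (0 < y)%N -> y \notin K ->
  \forall h \near 0^'+, h * b <= p h y 0 + \sum_(k <- K) p h y k.

Lemma indic_not0 y : \1_(~` [set 0%N]) y = 1 - (\1_[set 0%N] y : R).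
Proof.
rewrite indic1E indicE in_setC in_set1.
by case: eqVneq => _; rewrite /= ?subrr ?subr0.
Qed.

Lemma indic_not00 : \1_(~` [set 0%N]) 0%N = 0 :> R.
Proof. by rewrite indic_not0 indic1E eqxx subrr. Qed.

Lemma survivalE t x : 0 <= t -> u t x = 1 - p t x 0.
Proof.
move=> t0; rewrite /survival (funext indic_not0) (tsB sgT)//.
- by rewrite (ts_cst sgT).
- exact: bnd_cst.
- exact: bnd_indic.
Qed.

Lemma survival0 t : 0 <= t -> u t 0 = 0.
Proof. by move=> t0; rewrite survivalE// p00// subrr. Qed.

Lemma survival_itv t x : 0 <= t -> 0 <= u t x <= 1.
Proof. by move=> t0; apply: (ts_itv sgT) => // y; exact: indic_itv. Qed.

Lemma survival_bnd t : 0 <= t -> bnd (u t).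
Proof. by move=> t0; apply: bnd_le => x; exact: survival_itv. Qed.

Lemma survival_add s t x : 0 <= s -> 0 <= t -> u (s + t) x = T s (u t) x.
Proof. by move=> s0 t0; rewrite /survival (ts_comp sgT)//; exact: bnd_indic. Qed.

Lemma survival_anti s t x : 0 <= s -> s <= t -> u t x <= u s x.
Proof.
move=> s0 st; have ts0 : 0 <= t - s by rewrite subr_ge0.
rewrite -(subrKC s t) survival_add//; apply: (ts_le sgT) => //.
- exact: survival_bnd.
- exact: bnd_indic.
move=> [|y]; first by rewrite survival0// indic_not00.
have /andP[_ h] := survival_itv y.+1 ts0; apply: le_trans h _.
by rewrite indic_not0 indic1E subr0.
Qed.

Lemma trans_prob_comp_ge s t x y z : 0 <= s -> 0 <= t ->
  p s x y * p t y z <= p (s + t) x z.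
Proof.
move=> s0 t0; rewrite {3}/trans_prob (ts_comp sgT)//; last exact: bnd_indic.
have := @sum_trans_prob_le _ _ sgT s (p t ^~ z) x [:: y] s0.
rewrite big_seq1; apply => //.
  by apply: (ts_bnd sgT) => //; exact: bnd_indic.
by move=> w; exact: trans_prob_ge0.
Qed.

Lemma trans_prob_survival_ge s t x y : 0 <= s -> 0 <= t ->
  p s x y * u t y <= u (s + t) x.
Proof.
move=> s0 t0; rewrite survival_add//.
have := @sum_trans_prob_le _ _ sgT s (u t) x [:: y] s0.
rewrite big_seq1; apply => //; first exact: survival_bnd.
by move=> w; have /andP[] := survival_itv w t0.
Qed.

(** The supersolutions below are constant off [K] and 0.  One step of the
    semigroup on such functions involves only the transition probabilities to 0
    and to [K], which are the ones that the rate hypotheses control. *)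
Lemma ts_three_values h y (A v0 : R) (w : nat -> R) : 0 <= h ->
  T h (fun y => if y == 0%N then v0 else if y \in K then w y else A) y =
  A + (v0 - A) * p h y 0 + \sum_(k <- K) (w k - A) * p h y k.
Proof.
move=> h0.
have bZ c (k : nat) : bnd (fun z => c * (\1_[set k] z : R)).
  exact/bndZ/bnd_indic.
have -> : (fun y => if y == 0%N then v0 else if y \in K then w y else A) =
    (fun y => (A + (v0 - A) * \1_[set 0%N] y) +
              \sum_(k <- K) (w k - A) * \1_[set k] y).
  apply/funext => x; rewrite indic1E; under eq_bigr do rewrite indic1E.
  have [->|x0] /= := eqVneq x 0%N.
    rewrite big1_seq ?mulr1 ?addr0 ?subrKC// => k /= kK.
    by case: eqVneq => [k0|]; rewrite ?mulr0//; move: K0; rewrite k0 kK.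
  rewrite mulr0 addr0; have [xK|xK] := boolP (x \in K).
    rewrite (bigD1_seq x)//= eqxx mulr1 big1_seq ?addr0 ?subrKC//.
    by move=> k /andP[kx _]; rewrite eq_sym (negbTE kx) mulr0.
  rewrite big1_seq ?addr0// => k /= kK.
  by case: eqVneq => [kx|]; rewrite ?mulr0//; move: xK; rewrite kx kK.
have b1 : bnd (fun y => A + (v0 - A) * (\1_[set 0%N] y : R)).
  by apply: bndD => //; exact: bnd_cst.
rewrite (tsD sgT)//; last by apply: bnd_sum.
rewrite (tsD sgT)//; last exact: bnd_cst.
rewrite (ts_cst sgT)// (tsZ sgT)//; last exact: bnd_indic.
rewrite (ts_sum sgT)//; congr (_ + _).
by apply: eq_bigr => k _; rewrite (tsZ sgT)//; exact: bnd_indic.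
Qed.

(** Killing at rate at most [a] suggests the supersolution [j * h * a], after
    [j] steps, for the probability of having been absorbed. *)
Lemma absorption_le t y : 0 <= t -> (0 < y)%N -> p t y 0 <= a * t.
Proof.
rewrite le_eqVlt => /predU1P[<-|t0] y0.
  rewrite /trans_prob (ts_start sgT); last exact: bnd_indic.
  by rewrite indic1E gtn_eqF// mulr0.
rewrite /trans_prob.
apply: (maximum_principle sgT cT t0 (indic_itv R [set 0%N])) => N.
have near_a : \forall h \near (0 : R)^'+, forall x, (x < N)%N ->
    (0 < x)%N -> p h x 0 <= h * a.
  apply: near_forall_ltn => x; have [->|x0] := posnP x; first exact: nearW.
  by have := rate_kill x0; apply: filterS => h.
move: near_a (nbhs_right_gt (0 : R)); apply: filterS2 => h ha h0 n nh.
(* equal branches, in the shape of [ts_three_values] *)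
exists (fun j y => if y == 0%N then 1 else if y \in K then j%:R * h * a
                   else j%:R * h * a).
have vE j : 0 <= j%:R * h * a by rewrite !mulr_ge0// ltW.
split.
- move=> j; split.
    exists (1 + j%:R * h * a) => x; case: ifP => _.
      by rewrite normr1 lerDl.
    by rewrite if_same ger0_norm// lerDr.
  by move=> _ x; case: ifP => // _; rewrite if_same.
- move=> x; rewrite indic1E; case: ifP => // _.
  by rewrite if_same.
- move=> j x jn xN; have [->|x0] := posnP x.
    right; have hj : 0 <= j.+1%:R * h by rewrite mulr_ge0// ltW.
    by have /andP[_] := ts_itv sgT 0%N hj (indic_itv R [set 0%N]).
  left; rewrite (ts_three_values x _ _ _ (ltW h0)) /= if_same.
  rewrite big1 ?addr0; last by move=> k _; rewrite subrr mul0r.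
  have := ha x xN x0; have := trans_prob_ge0 sgT x 0 (ltW h0).
  rewrite -[j.+1]addn1 natrD; have := vE j.
  set A := _ * a; set B := p h x 0 => ? ? ?.
  have : 0 <= A * B by rewrite mulr_ge0.
  by rewrite !mulrDl mul1r -/A; lra.
- by rewrite if_same gtn_eqF// nh mulrC.
Qed.

Lemma survival_ge_lin t y : 0 <= t -> (0 < y)%N -> 1 - a * t <= u t y.
Proof. by move=> t0 y0; rewrite survivalE// lerD2l lerN2 absorption_le. Qed.

(** From any surviving state, absorption within a further time [h] has
    probability at most [a * h]. *)
Lemma survival_decay s h y : 0 <= s -> 0 <= h ->
  (1 - a * h) * u s y <= u (s + h) y.
Proof.
move=> s0 h0; rewrite survival_add// {1}/survival -(tsZ sgT)//;
  last exact: bnd_indic.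
apply: (ts_le sgT) => //; first exact/bndZ/bnd_indic.
  exact: survival_bnd.
move=> [|x]; first by rewrite indic_not00 mulr0 survival0.
by rewrite indic_not0 indic1E subr0 mulr1 survival_ge_lin.
Qed.

Lemma b0 : 0 < b. Proof. exact: lt_trans a0 ab. Qed.

Variable z : nat.
Hypothesis zK : z \in K.
Hypothesis comm : forall x y t, x \in K -> y \in K -> 0 < t -> 0 < p t x y.

Lemma K_gt0 y : y \in K -> (0 < y)%N.
Proof. by case: y => // y0; move: K0; rewrite y0. Qed.

Lemma survival_start y : (0 < y)%N -> u 0 y = 1.
Proof.
move=> y0; rewrite /survival (ts_start sgT); last exact: bnd_indic.
by rewrite indic_not0 indic1E gtn_eqF// subr0.
Qed.

(** No state survives much better than [z].  For the states of [K] this holds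
    because [z] visits each of them at time 1 with positive probability.  Off
    [K] the supersolution is [C * u (j * h) z]: during one step [u z] loses at
    most a fraction [a * h], while with probability at least [b * h] the chain
    enters [K] or 0, where the value to be dominated is smaller than
    [C * u (j * h) z] by a fixed factor.  As [a < b], a large [C] makes this
    drop win over the loss. *)
Lemma survival_compare : exists2 C, 1 <= C &
  forall t x, 0 <= t -> u t x <= C * u t z.
Proof.
have [x xK|c [/andP[c0 c1] pc]] := @seq_lower_bound R K (p 1 z).
  by rewrite comm.
have uK t x : 0 <= t -> x \in K -> u t x <= c^-1 * u t z.
  move=> t0 xK; rewrite ler_pdivlMl//.
  have tt : t <= 1 + t by rewrite lerDr.
  apply: le_trans (survival_anti z t0 tt).
  apply: le_trans (trans_prob_survival_ge z x ler01 t0).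
  by rewrite ler_wpM2r ?pc//; have /andP[] := survival_itv x t0.
have ic1 : 1 <= c^-1 by rewrite invf_ge1.
have ba0 : 0 < b - a by rewrite subr_gt0.
(* the root of [b * (C - c^-1) = a * C], which balances the drop against the
   loss *)
pose C := c^-1 * (b / (b - a)).
have C0 : c^-1 <= C.
  rewrite ler_peMr ?invr_ge0 ?(ltW c0)// ler_pdivlMr// mul1r lerBlDr.
  by rewrite lerDl ltW.
have C1 : 1 <= C by exact: le_trans C0.
have Cpos : 0 <= C by exact: le_trans C1.
have Cb : b * (C - c^-1) = a * C.
  by rewrite /C; field; rewrite (gt_eqF c0) (gt_eqF ba0).
exists C => // t x; rewrite le_eqVlt => /predU1P[<-|t0].
  rewrite (survival_start (K_gt0 zK)) mulr1 (le_trans _ C1)//.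
  by have /andP[] := survival_itv x (lexx 0).
have [->|x0] := posnP x.
  rewrite (survival0 (ltW t0)) mulr_ge0//.
  by have /andP[] := survival_itv z (ltW t0).
rewrite [leLHS]/survival.
apply: (maximum_principle sgT cT t0 (indic_itv R (~` [set 0%N]))) => N.
have near_b : \forall h \near (0 : R)^'+, forall x, (x < N)%N ->
    (0 < x)%N -> x \notin K -> h * b <= p h x 0 + \sum_(k <- K) p h x k.
  apply: near_forall_ltn => y.
  have [->|y0] := posnP y; first exact: nearW.
  have [yK|yK] := boolP (y \in K); first exact: nearW.
  by have := rate_return y0 yK; apply: filterS => h.
move: near_b (nbhs_right_gt (0 : R)); apply: filterS2 => h hb h0 n nh.
have jh0 j : 0 <= j%:R * h by rewrite mulr_ge0// ltW.
exists (fun j y => if y == 0%N then 0 else if y \in K then u (j%:R * h) y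
                   else C * u (j%:R * h) z).
split.
- move=> j.
  have v0C y : 0 <= (if y == 0%N then 0 else if y \in K then u (j%:R * h) y
                     else C * u (j%:R * h) z) <= C.
    case: ifP => _; first by rewrite lexx.
    have /andP[w0 w1] := survival_itv y (jh0 j).
    have /andP[w0' w1'] := survival_itv z (jh0 j).
    case: ifP => _; first by rewrite w0 (le_trans w1).
    by rewrite mulr_ge0//= -[leRHS]mulr1 ler_wpM2l.
  by split; [exact: bnd_le v0C|move=> _ y; have /andP[] := v0C y].
- move=> y; rewrite mul0r; have [->|y0] := posnP y.
    by rewrite indic_not00.
  have /andP[_ le1] := indic_itv R (~` [set 0%N]) y.
  rewrite /=; case: ifP => yK; first by rewrite survival_start.
  by rewrite (survival_start (K_gt0 zK)) mulr1 (le_trans le1).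
- move=> j y jn yN.
  have [->|y0] := posnP y; first by right; rewrite -/(u _ _) survival0.
  have [yK|yK] /= := boolP (y \in K); first by right.
  left; rewrite (ts_three_values y _ _ _ (ltW h0)).
  have g0 : 0 <= u (j%:R * h) z by have /andP[] := survival_itv z (jh0 j).
  have decay := survival_decay z (jh0 j) (ltW h0).
  have := hb y yN y0 yK; have o0 := trans_prob_ge0 sgT y 0 (ltW h0).
  have -> : j.+1%:R * h = j%:R * h + h by rewrite -addn1 natrD mulrDl mul1r.
  move: decay g0; set g := u _ z; set g' := u _ z; set o := p h y 0.
  have : \sum_(k <- K) (u (j%:R * h) k - C * g) * p h y k <=
         - ((C - c^-1) * g) * \sum_(k <- K) p h y k.
    rewrite mulr_sumr !big_seq; apply: ler_sum => k kK.
    rewrite ler_wpM2r ?(trans_prob_ge0 sgT _ _ (ltW h0))//.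
    by have := uK _ k (jh0 j) kK; rewrite -/g; lra.
  set S := \sum_(_ <- _) _; set k := \sum_(_ <- _) _ => Sk decay g0 ok.
  have k0 : 0 <= k.
    by apply: sumr_ge0 => i _; exact: (trans_prob_ge0 sgT _ _ (ltW h0)).
  (* [o] and [k] are the probabilities of stepping to 0 and to [K]; the balance
     equation for [C] cancels the coefficient of [k] that is left over *)
  have main : 0 <= C * o + (C - c^-1) * k - C * (a * h).
    rewrite -(pmulr_rge0 _ b0).
    have -> : b * (C * o + (C - c^-1) * k - C * (a * h)) =
       C * (a * (o + k - h * b)) + C * (b - a) * o +
       (b * (C - c^-1) - a * C) * k.
      by ring.
    rewrite Cb subrr mul0r addr0; have a0' := ltW a0; have ba0' := ltW ba0.
    apply: addr_ge0; apply: mulr_ge0 => //; apply: mulr_ge0 => //.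
    by rewrite subr_ge0.
  have := mulr_ge0 main g0; have := ler_wpM2l Cpos decay.
  move: Sk; nra.
- rewrite gtn_eqF// nh; case: ifP => [xK|_] //.
  apply: le_trans (uK _ _ (ltW t0) xK) _; rewrite ler_wpM2r//.
  by have /andP[] := survival_itv z (ltW t0).
Qed.

Hypothesis hold : \forall h \near 0^'+, 2^-1 <= p h z z.

(** The time interval is cut into pieces so short that [z] is occupied at the
    end of each with probability at least one half. *)
Lemma holding_lower_bound : exists2 c, 0 < c <= 1 &
  forall s, 0 <= s <= 2^-1 -> c <= p s z z.
Proof.
have [e e0 he] := near_right0 hold.
pose m := (Num.truncn e^-1).+1.
have m0 : (0 : R) < m%:R by rewrite ltr0n.
have me : m%:R^-1 < e.
  by rewrite invf_plt ?posrE// truncnS_gt.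
exists (2^-1 ^+ m); first by rewrite exprn_gt0//= exprn_ile1// invf_le1// ler1n.
move=> s /andP[s0 s1].
have sm0 : 0 <= s / m%:R by rewrite divr_ge0// ltW.
have small : 2^-1 <= p (s / m%:R) z z.
  move: sm0; rewrite le_eqVlt => /predU1P[<-|sm0].
    rewrite /trans_prob (ts_start sgT); last exact: bnd_indic.
    by rewrite indic1E eqxx invf_le1// ler1n.
  apply: he; rewrite sm0 (le_lt_trans _ me)// ler_piMl ?invr_ge0 ?ltW//.
  by rewrite (le_lt_trans s1)// invf_lt1// ltr1n.
have -> : s = m%:R * (s / m%:R) by rewrite mulrC divfK// gt_eqF.
move: (s / m%:R) sm0 small => r r0 small.
elim: (m) => [|k IH].
  rewrite mul0r /trans_prob (ts_start sgT); last exact: bnd_indic.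
  by rewrite indic1E eqxx expr0.
rewrite -[k.+1]addn1 addnC natrD mulrDl mul1r addnC addn1 exprS.
have kr0 : 0 <= k%:R * r by rewrite mulr_ge0.
apply: le_trans (trans_prob_comp_ge z z z r0 kr0).
by apply: ler_pM => //; rewrite ?exprn_ge0 ?invr_ge0.
Qed.

(** Within time one half the chain enters [K] before 0 with probability bounded
    below, since it returns at rate [b] and is killed at rate [a < b]; once in
    [K], it is at [z] at any given time between one half and one later with
    probability at least [c].  To make the first part a comparison, follow the
    mean of [f = 1 - p 2^-1 _ z] over a time one half: it is at most [1 - c] at
    the states of [K], and off [K] and 0 the supersolution [1 - c * (j * h * l)]
    decreases linearly in time. *)
Lemma minorization : exists2 c, 0 < c <= 1 &
  forall x, (0 < x)%N -> c <= p 1 x z.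
Proof.
have half0 : (0 : R) < 2^-1 by rewrite invr_gt0.
have half1 : 2^-1 + 2^-1 = 1 :> R by lra.
have [c1 /andP[c10 c11] hc1] := holding_lower_bound.
have [y yK|c2 [/andP[c20 c21] hc2]] := @seq_lower_bound R K (p 2^-1 ^~ z).
  by rewrite comm.
pose c := c2 * c1.
have c0 : 0 < c by rewrite mulr_gt0.
have cle1 : c <= 1 by rewrite mulr_ile1// ltW.
have cK s y : 0 <= s <= 2^-1 -> y \in K -> c <= p (s + 2^-1) y z.
  move=> /andP[s0 s1] yK; rewrite addrC.
  apply: le_trans (trans_prob_comp_ge y z z (ltW half0) s0).
  by apply: ler_pM; rewrite ?(ltW c10) ?(ltW c20)// ?hc2// hc1// s0.
have [b_gt0 ba0] : 0 < b /\ 0 < b - a by rewrite b0 subr_gt0.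
have b20 : 0 < 1 + b / 2 by lra.
(* the slope for which the one-step inequality is an equality at the final
   time: [l = b * (1 - l / 2) - a] *)
pose l := (b - a) / (1 + b / 2).
have l0 : 0 < l by rewrite divr_gt0.
have lE : l * (1 + b / 2) = b - a by rewrite divfK// gt_eqF.
have l2 : l / 2 <= 1 by move: l0 lE a0; nra.
exists (c * (l / 2)).
  by rewrite mulr_gt0 ?divr_gt0//= mulr_ile1// ltW// divr_gt0.
move=> x x0.
pose f y := 1 - p 2^-1 y z.
have f01 y : 0 <= f y <= 1.
  by have := trans_prob_itv sgT y z (ltW half0); rewrite /f; lra.
have bf := bnd_le f01.
have Tf s y : 0 <= s -> T s f y = 1 - p (s + 2^-1) y z.
  move=> s0; rewrite /f (tsB sgT)//; last 2 first.
  - exact: bnd_cst.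
  - by apply: (ts_bnd sgT); rewrite ?ltW//; exact: bnd_indic.
  by rewrite (ts_cst sgT)// -(ts_comp sgT) ?(ltW half0)//; exact: bnd_indic.
suff : T 2^-1 f x <= 1 - c * (l / 2).
  by rewrite (Tf _ _ (ltW half0)) half1; lra.
apply: (maximum_principle sgT cT half0 f01) => N.
have near_ab : \forall h \near (0 : R)^'+, forall y, (y < N)%N ->
    (0 < y)%N -> y \notin K ->
    p h y 0 <= h * a /\ h * b <= p h y 0 + \sum_(k <- K) p h y k.
  apply: near_forall_ltn => y.
  have [->|y0] := posnP y; first exact: nearW.
  have [yK|yK] := boolP (y \in K); first exact: nearW.
  by move: (rate_kill y0) (rate_return y0 yK); apply: filterS2 => h.
move: near_ab (nbhs_right_gt (0 : R)); apply: filterS2 => h hab h0 n nh.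
have jh0 j : 0 <= j%:R * h by rewrite mulr_ge0// ltW.
have jh1 j : (j <= n)%N -> j%:R * h <= 2^-1.
  by move=> jn; rewrite -nh ler_wpM2r ?(ltW h0)// ler_nat.
exists (fun j y => if y == 0%N then 1 else if y \in K then 1 - c
                   else 1 - c * (j%:R * h * l)).
split.
- move=> j; split.
    exists (1 + c + c * (j%:R * h * l)) => y.
    have w0 : 0 <= c * (j%:R * h * l).
      by rewrite (mulr_ge0 (ltW c0))// (mulr_ge0 (jh0 j))// ltW.
    by rewrite /= ler_norml; case: ifP => _; [|case: ifP => _];
      apply/andP; split; lra.
  move=> jn y; case: ifP => // _; case: ifP => _; first by rewrite subr_ge0.
  have jl0 : 0 <= j%:R * h * l by rewrite mulr_ge0// ltW.
  rewrite subr_ge0 mulr_ile1// ?(ltW c0)//.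
  apply: le_trans l2; rewrite mulrC ler_wpM2l ?(ltW l0)//; exact: jh1.
- move=> y; have /andP[_ f1] := f01 y; rewrite !mul0r mulr0 subr0.
  case: ifP => // _; case: ifP => // yK; rewrite /f.
  by have := hc2 y yK; have := ler_piMr (ltW c20) c11; rewrite -/c; lra.
- move=> j y jn yN; have [->|y0] := posnP y.
    by right; have /andP[_] := ts_itv sgT 0%N (jh0 j.+1) f01.
  have [yK|yK] /= := boolP (y \in K).
    right; rewrite Tf// lerD2l lerN2 cK//.
    by rewrite jh0 jh1.
  left; rewrite (ts_three_values y _ _ _ (ltW h0)).
  have [oa okb] := hab y yN y0 yK; have o0 := trans_prob_ge0 sgT y 0 (ltW h0).
  rewrite -mulr_sumr; move: okb oa o0.
  have -> : j.+1%:R * h = j%:R * h + h by rewrite -addn1 natrD mulrDl mul1r.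
  set o := p h y 0; set k := \sum_(_ <- _) _ => okb oa o0.
  have m0 : 0 <= j%:R * h * l by rewrite mulr_ge0// ltW.
  have m1 : j%:R * h * l <= l / 2.
    by rewrite mulrC ler_wpM2l ?(ltW l0)// jh1// ltnW.
  move: m0 m1; rewrite [(_ + h) * l]mulrDl; set m := j%:R * h * l => m0 m1.
  have main : h * l <= (1 - m) * (k + o) - o.
    have : (1 - l / 2) * (h * b) <= (1 - m) * (k + o).
      by apply: ler_pM;
        rewrite ?subr_ge0 ?mulr_ge0 ?(ltW h0) ?(ltW b_gt0)//; lra.
    have : h * (l * (1 + b / 2)) = h * (b - a) by rewrite lE.
    by lra.
  have := ler_wpM2l (ltW c0) main; lra.
- rewrite gtn_eqF// nh; case: ifP => [xK|_].
    by rewrite lerD2l lerN2 ler_piMr// ltW.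
  by rewrite [2^-1 * l]mulrC.
Qed.

End Rates.

(** * Contraction of conditional means *)

Lemma probability_of_weights (R : realType) (w : nat -> R) :
  (forall n, 0 <= w n) -> (\sum_(0 <= n <oo) (w n)%:E = 1)%E ->
  exists rho : probability nat R, forall n, rho [set n] = (w n)%:E.
Proof.
move=> w0 w1.
pose m : {measure set nat -> \bar R} :=
  mseries (fun n => mscale (NngNum (w0 n)) (@dirac _ nat n R)) 0.
have mE (A : set nat) : m A = (\sum_(0 <= k <oo) (w k)%:E * (\d_k A))%E by [].
have mT : m setT = 1%E.
  by rewrite mE -w1; apply: eq_eseriesr => k _; rewrite diracT mule1.
(* [m] has mass 1, and [mnormalize] leaves such a measure unchanged *)
exists (mnormalize m (@dirac _ nat 0%N R)) => n.
rewrite /= /mnormalize /= mT /= onee_eq0 /= invr1 mule1 mE.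
rewrite -[RHS](@esum_set1 _ _ n (fun k => (w k)%:E)) ?lee_fin//.
have -> : [set n] = [set k | k == n].
  by apply/seteqP; split=> k /= => [->|/eqP].
rewrite -nneseries_esum => [|k _]; last by rewrite lee_fin.
rewrite [RHS]eseries_mkcond; apply: eq_eseriesr => k _.
rewrite diracE; case: ifP => [/eqP ->|kn]; first by rewrite mem_set ?mule1/=.
by rewrite memNset ?mule0//= kn.
Qed.

Lemma eseries_eq1 (R : realType) (w : nat -> R) : (forall n, 0 <= w n) ->
  (forall N, \sum_(0 <= n < N) w n <= 1) ->
  (forall e, 0 < e -> exists N, 1 - e <= \sum_(0 <= n < N) w n) ->
  (\sum_(0 <= n <oo) (w n)%:E = 1)%E.
Proof.
move=> w0 wle wge; apply/eqP; rewrite eq_le; apply/andP; split.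
  apply: lime_le.
    by apply: is_cvg_nneseries => n _ _; rewrite lee_fin.
  by apply: nearW => N; rewrite sumEFin lee_fin.
apply/lee_addgt0Pr => e e0; have [N hN] := wge e e0.
rewrite -leeBlDr//; apply: le_trans; last first.
  apply: (@nneseries_lim_ge _ _ xpredT 0 N) => n _ _.
  by rewrite lee_fin.
by rewrite sumEFin -EFinB lee_fin.
Qed.

Lemma cvg_geometric0 (R : realType) (M g : R) : 0 < g < 1 ->
  M * (1 - g) ^+ n @[n --> \oo] --> (0 : R).
Proof.
move=> /andP[g0 g1]; rewrite -(mulr0 M).
by apply: cvgMr; apply: cvg_expr; rewrite ger0_norm; lra.
Qed.

Section Doeblin.
Context (R : realType) (T : R -> (nat -> R) -> nat -> R).
Hypothesis sgT : transition_semigroup T.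
Hypothesis cT : confined T.
Local Notation p := (trans_prob T).
Local Notation u := (survival T).
Hypothesis p00 : forall t, 0 <= t -> p t 0 0 = 1.
Variables (z : nat) (c C : R).
Hypothesis z0 : (0 < z)%N.
Hypothesis c01 : 0 < c <= 1.
Hypothesis minor : forall x, (0 < x)%N -> c <= p 1 x z.
Hypothesis C1 : 1 <= C.
Hypothesis compare : forall t x, 0 <= t -> u t x <= C * u t z.

Let c0 : 0 < c. Proof. by have /andP[] := c01. Qed.
Let C0 : 0 < C. Proof. exact: lt_le_trans C1. Qed.

(** The mean of [f] at time [t] conditioned on survival is [T t f x / u t x] when
    [f] vanishes at 0.  Without the division the state 0, from which nothing
    survives, needs no separate treatment. *)
Definition cond_means_in (lo hi t : R) (f : nat -> R) :=
  forall x, lo * u t x <= T t f x <= hi * u t x.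

(* The factor 2 keeps [gamma] below 1 when [c = C = 1]. *)
Let gamma := c / (2 * C).

Lemma gamma_itv : 0 < gamma < 1.
Proof.
rewrite divr_gt0 ?mulr_gt0//= ltr_pdivrMr ?mulr_gt0// mul1r.
by have /andP[_] := c01; move: C1; lra.
Qed.

(** Uniform in [x], so that the survival probability under any initial law on N*
    is positive. *)
Lemma survival_lower_bound t : 0 <= t -> exists2 d, 0 < d &
  forall x, (0 < x)%N -> d <= u t x.
Proof.
move=> t0.
have un n : c ^+ n <= u n%:R z.
  elim: n => [|n IH]; first by rewrite expr0 (survival_start sgT).
  rewrite -[n.+1]addn1 addnC natrD exprD expr1.
  apply: le_trans (trans_prob_survival_ge sgT z z ler01 (ler0n R n)).
  by apply: ler_pM; rewrite ?exprn_ge0 ?(ltW c0)// minor.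
pose n := (Num.truncn t).+1.
have tn : t <= n%:R by rewrite ltW// truncnS_gt.
exists (c * c ^+ n) => [|x x0]; first by rewrite mulr_gt0// exprn_gt0.
have t1 : t <= 1 + t by rewrite lerDr.
apply: le_trans (survival_anti sgT p00 x t0 t1).
apply: le_trans (trans_prob_survival_ge sgT x z ler01 t0).
apply: ler_pM; rewrite ?exprn_ge0 ?(ltW c0)// ?minor//.
exact: le_trans (un n) (survival_anti sgT p00 z t0 tn).
Qed.

Lemma survival_gt0 t x : 0 <= t -> (0 < x)%N -> 0 < u t x.
Proof.
move=> t0 x0; have [d d0 /(_ x x0)] := survival_lower_bound t0.
exact: lt_le_trans.
Qed.

Lemma cond_means_in_add s t lo hi f : 0 <= s -> 0 <= t -> bnd f ->
  cond_means_in lo hi t f -> cond_means_in lo hi (s + t) f.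
Proof.
move=> s0 t0 bf h x; rewrite (survival_add sgT)// (ts_comp sgT)//.
have bu := survival_bnd sgT t0.
rewrite -!(tsZ sgT)//; apply/andP; split; apply: (ts_le sgT) => //;
  try exact: bndZ; try exact: (ts_bnd sgT).
- by move=> y; have /andP[] := h y.
- by move=> y; have /andP[] := h y.
Qed.

Lemma cond_means_in_le s t lo hi f : 0 <= t -> t <= s -> bnd f ->
  cond_means_in lo hi t f -> cond_means_in lo hi s f.
Proof.
move=> t0 ts bf h; rewrite -(subrK t s).
by apply: cond_means_in_add; rewrite // subr_ge0.
Qed.

(** Conditioning on survival up to [1 + t] weighs a state [y] reached at time 1
    by [p 1 x y * u t y / u (1 + t) x].  By [minor] and [compare] the weight of
    [z] is at least [gamma], whatever [x] is. *)
Lemma doeblin_bound t f : 0 <= t -> bnd f -> f 0%N = 0 ->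
  (forall x, 0 <= T t f x) -> forall x,
  gamma * (T t f z / u t z) * u (1 + t) x <= T (1 + t) f x.
Proof.
move=> t0 bf f0 Tf0 x; have uz := survival_gt0 t0 z0.
have r0 : 0 <= T t f z / u t z by rewrite divr_ge0// ltW.
have t1 : 0 <= 1 + t by rewrite addr_ge0.
have [->|x0] := posnP x.
  rewrite (survival0 sgT p00)// mulr0 (ts_comp sgT)//.
  by apply: (ts_ge0 sgT) => //; exact: (ts_bnd sgT).
apply: (@le_trans _ _ (c * T t f z)); last first.
  have := @sum_trans_prob_le _ _ sgT 1 (T t f) x [:: z] ler01.
  rewrite big_seq1 -(ts_comp sgT)// => le.
  apply: le_trans (le _ _ _) => //; last exact: (ts_bnd sgT).
  by rewrite ler_wpM2r// minor.
have uC : u (1 + t) x <= C * u t z.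
  apply: le_trans (compare x t0).
  by apply: (survival_anti sgT p00) => //; rewrite lerDr.
apply: (@le_trans _ _ (gamma * (T t f z / u t z) * (C * u t z))).
  by rewrite ler_wpM2l// mulr_ge0// ltW//; have /andP[] := gamma_itv.
have -> : gamma * (T t f z / u t z) * (C * u t z) = c * T t f z / 2.
  by rewrite /gamma; field; rewrite !gt_eqF.
have : 0 <= c * T t f z by rewrite mulr_ge0// ltW.
lra.
Qed.

(** [doeblin_bound] for [f - lo] and for [hi - f]: both ends move towards the
    conditional mean [r] at [z] by a fraction [gamma]. *)
Lemma cond_means_in_step t f lo hi : 0 <= t -> bnd f -> f 0%N = 0 ->
  cond_means_in lo hi t f ->
  exists lo' hi', hi' - lo' = (1 - gamma) * (hi - lo) /\
    cond_means_in lo' hi' (1 + t) f.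
Proof.
move=> t0 bf f0 h; have uz := survival_gt0 t0 z0.
set r := T t f z / u t z.
have bI := bnd_indic R (~` [set 0%N]).
have I0 := indic_not00 R.
have t1 : 0 <= 1 + t by rewrite addr_ge0.
exists (lo + gamma * (r - lo)), (hi - gamma * (hi - r)); split; first by ring.
move=> x; apply/andP; split.
- have := @doeblin_bound t (fun y => f y - lo * \1_(~` [set 0%N]) y) t0.
  have Te s y : 0 <= s -> T s (fun y => f y - lo * \1_(~` [set 0%N]) y) y =
      T s f y - lo * u s y.
    by move=> s0; rewrite (tsB sgT)//; [rewrite (tsZ sgT)|exact: bndZ].
  rewrite !Te// I0 f0 mulr0 subrr => /(_ _ _ _ x) H.
  have {H} := H (bndB bf (bndZ lo bI)) erefl.
  rewrite mulrBl mulfK ?gt_eqF// -/r => H.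
  have := H _.
  have : forall y, 0 <= T t (fun y => f y - lo * \1_(~` [set 0%N]) y) y.
    by move=> y; rewrite Te// subr_ge0; have /andP[] := h y.
  by move=> Q /(_ Q); rewrite Te//; lra.
- have := @doeblin_bound t (fun y => hi * \1_(~` [set 0%N]) y - f y) t0.
  have Te s y : 0 <= s -> T s (fun y => hi * \1_(~` [set 0%N]) y - f y) y =
      hi * u s y - T s f y.
    by move=> s0; rewrite (tsB sgT)//; [rewrite (tsZ sgT)|exact: bndZ].
  rewrite !Te// I0 f0 mulr0 subrr => /(_ _ _ _ x) H.
  have {H} := H (bndB (bndZ hi bI) bf) erefl.
  rewrite mulrBl mulfK ?gt_eqF// -/r => H.
  have := H _.
  have : forall y, 0 <= T t (fun y => hi * \1_(~` [set 0%N]) y - f y) y.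
    by move=> y; rewrite Te// subr_ge0; have /andP[] := h y.
  by move=> Q /(_ Q); rewrite Te//; lra.
Qed.

Lemma exists_cond_means_in t f (M : R) : 0 <= t -> f 0%N = 0 ->
  (forall x, `|f x| <= M) ->
  exists lo hi, hi - lo = 2 * M * (1 - gamma) ^+ Num.truncn t /\
    cond_means_in lo hi t f.
Proof.
move=> t0 f0 fM; have bf : bnd f by exists M.
have base s : 0 <= s -> cond_means_in (- M) M s f.
  move=> s0 x; rewrite /survival -!(tsZ sgT)//; try exact: bnd_indic.
  have fI y : - M * \1_(~` [set 0%N]) y <= f y <= M * \1_(~` [set 0%N]) y.
    rewrite indic_not0 indic1E; case: eqVneq => [->|_].
      by rewrite f0 subrr !mulr0 lexx.
    by rewrite subr0 !mulr1 -ler_norml.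
  apply/andP; split; apply: (ts_le sgT) => //; try by apply/bndZ/bnd_indic.
  - by move=> y; have /andP[] := fI y.
  - by move=> y; have /andP[] := fI y.
have step n s : 0 <= s -> exists lo hi,
    hi - lo = 2 * M * (1 - gamma) ^+ n /\ cond_means_in lo hi (n%:R + s) f.
  move=> s0; elim: n => [|n [lo [hi [e k]]]].
    exists (- M), M; split; first by rewrite expr0; ring.
    by rewrite add0r; exact: base.
  have ns : 0 <= n%:R + s by rewrite addr_ge0.
  have [lo' [hi' [e' k']]] := cond_means_in_step ns bf f0 k.
  exists lo', hi'; split; first by rewrite e' e exprS; ring.
  by rewrite -[n.+1]addn1 addnC natrD -addrA.
have [|lo [hi [e k]]] := step (Num.truncn t) (t - (Num.truncn t)%:R).
  by rewrite subr_ge0 truncn_le.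
by exists lo, hi; split=> //; rewrite subrKC in k.
Qed.

(** * The limit law *)

(** A lower bound for the conditional means at one time stays below every upper
    bound obtained at any other time, so the supremum of the lower bounds is the
    limit of the conditional means. *)
Definition limit_mean (f : nat -> R) : R :=
  sup [set lo | exists2 t, 0 <= t & forall x, lo * u t x <= T t f x].

Lemma limit_mean_in lo hi t f : 0 <= t -> bnd f -> cond_means_in lo hi t f ->
  lo <= limit_mean f <= hi.
Proof.
move=> t0 bf h.
have in_lo : [set lo | exists2 t, 0 <= t & forall x, lo * u t x <= T t f x] lo.
  by exists t => // x; have /andP[] := h x.
have hi_ub : ubound [set lo | exists2 t, 0 <= t &
    forall x, lo * u t x <= T t f x] hi.
  move=> l [s s0 ls].
  have st : 0 <= s + t by rewrite addr_ge0.
  have uz := survival_gt0 st z0.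
  rewrite -(ler_pM2r uz).
  have /andP[_ ] := cond_means_in_add s0 t0 bf h z; apply: le_trans.
  rewrite [s + t]addrC (survival_add sgT)// (ts_comp sgT)// -(tsZ sgT)//.
    apply: (ts_le sgT) => //; last exact: (ts_bnd sgT).
    by apply: bndZ; exact: (survival_bnd sgT).
  exact: (survival_bnd sgT).
apply/andP; split; last by apply: ge_sup => //; exists lo.
by apply: ub_le_sup => //; exists hi.
Qed.

(** The shift by [t] serves in [limit_mean_ts], where times that are not integers
    have to be compared with integer ones. *)
Lemma cvg_limit_mean f : bnd f -> f 0%N = 0 ->
  forall t, 0 <= t ->
  T (n%:R + t) f z / u (n%:R + t) z @[n --> \oo] --> limit_mean f.
Proof.
move=> bf f0 t t0; have [M fM] := bf.
apply/cvgrPdist_le => e e0.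
have /cvgrPdist_le /(_ e e0) := cvg_geometric0 (2 * M) gamma_itv.
apply: filterS => n.
rewrite sub0r normrN => ne.
have [lo [hi [e1 k]]] := exists_cond_means_in (ler0n R n) f0 fM.
have /andP[l1 l2] := limit_mean_in (ler0n R n) bf k.
have nt : n%:R <= n%:R + t by rewrite lerDl.
have nt0 : 0 <= n%:R + t by rewrite addr_ge0.
have /andP[] := cond_means_in_le (ler0n R n) nt bf k z.
have uz := survival_gt0 nt0 z0.
rewrite -(ler_pdivlMr _ _ uz) -(ler_pdivrMr _ _ uz) => r1 r2.
rewrite natrK in e1.
apply: le_trans ne; apply: le_trans (ler_norm _); rewrite -e1 ler_norml.
by apply/andP; split; lra.
Qed.

Lemma limit_meanE f l : bnd f -> f 0%N = 0 ->
  T n%:R f z / u n%:R z @[n --> \oo] --> l -> limit_mean f = l.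
Proof.
move=> bf f0 h; have := cvg_limit_mean bf f0 (lexx 0).
under eq_fun do rewrite addr0.
by move=> h'; apply: (cvg_unique _ h' h).
Qed.

Lemma cvg_limit_mean0 f : bnd f -> f 0%N = 0 ->
  T n%:R f z / u n%:R z @[n --> \oo] --> limit_mean f.
Proof.
move=> bf f0; have := cvg_limit_mean bf f0 (lexx 0).
by under eq_fun do rewrite addr0.
Qed.

Lemma limit_meanB f g : bnd f -> f 0%N = 0 -> bnd g -> g 0%N = 0 ->
  limit_mean (fun x => f x - g x) = limit_mean f - limit_mean g.
Proof.
move=> bf f0 bg g0; apply: limit_meanE; first exact: bndB.
  by rewrite f0 g0 subrr.
under eq_fun do rewrite (tsB sgT)// mulrBl.
by apply: cvgB; exact: cvg_limit_mean0.
Qed.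

Lemma limit_meanZ a f : bnd f -> f 0%N = 0 ->
  limit_mean (fun x => a * f x) = a * limit_mean f.
Proof.
move=> bf f0; apply: limit_meanE; first exact: bndZ.
  by rewrite f0 mulr0.
under eq_fun do rewrite (tsZ sgT)// -mulrA.
by apply: cvgMr; exact: cvg_limit_mean0.
Qed.

Lemma limit_mean_ge0 f : bnd f -> f 0%N = 0 -> (forall x, 0 <= f x) ->
  0 <= limit_mean f.
Proof.
move=> bf f0 fpos; have [M fM] := bf.
have k : cond_means_in 0 M 0 f.
  move=> x; rewrite mul0r (ts_start sgT)// fpos/=.
  have [->|x0] := posnP x; first by rewrite f0 (survival0 sgT p00)// mulr0.
  by rewrite (survival_start sgT)// mulr1 (le_trans (ler_norm _)).
by have /andP[] := limit_mean_in (lexx 0) bf k.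
Qed.

Lemma limit_mean_le f g : bnd f -> f 0%N = 0 -> bnd g -> g 0%N = 0 ->
  (forall x, f x <= g x) -> limit_mean f <= limit_mean g.
Proof.
move=> bf f0 bg g0 fg; rewrite -subr_ge0 -limit_meanB//.
apply: limit_mean_ge0; first exact: bndB.
  by rewrite f0 g0 subrr.
by move=> x; rewrite subr_ge0.
Qed.

Lemma limit_mean1 : limit_mean \1_(~` [set 0%N]) = 1.
Proof.
have k : cond_means_in 1 1 0 \1_(~` [set 0%N]) by move=> x; rewrite !mul1r lexx.
apply/eqP; rewrite eq_le andbC.
exact: (limit_mean_in (lexx 0) (bnd_indic R _) k).
Qed.

Lemma limit_meanD f g : bnd f -> f 0%N = 0 -> bnd g -> g 0%N = 0 ->
  limit_mean (fun x => f x + g x) = limit_mean f + limit_mean g.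
Proof.
move=> bf f0 bg g0; apply: limit_meanE; first exact: bndD.
  by rewrite f0 g0 addr0.
under eq_fun do rewrite (tsD sgT)// mulrDl.
by apply: cvgD; exact: cvg_limit_mean0.
Qed.

(** [limit_mean] is meaningful on functions that vanish at 0, which excludes the
    indicator of 0. *)
Definition limit_weight (y : nat) : R :=
  if y == 0%N then 0 else limit_mean \1_[set y].

Lemma limit_weight_ge0 y : 0 <= limit_weight y.
Proof.
rewrite /limit_weight; case: eqVneq => // y0; apply: limit_mean_ge0.
- exact: bnd_indic.
- by rewrite indic1E eq_sym (negbTE y0).
- by move=> x; have /andP[] := indic_itv R [set y] x.
Qed.

Lemma indic_IIE N y : \1_(`I_N) y = (y < N)%:R :> R.
Proof.
by rewrite indicE; congr (nat_of_bool _)%:R; apply/idP/idP; rewrite inE.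
Qed.

Lemma bnd_cut N (f : nat -> R) : bnd f -> bnd (fun y => f y * \1_(`I_N) y).
Proof.
move=> [M fM]; exists M => y; rewrite indic_IIE normrM.
case: ltnP => _; rewrite /= ?normr1 ?normr0 ?mulr1 ?mulr0//.
exact: le_trans (fM y).
Qed.

Lemma sum_limit_weight N f : bnd f -> f 0%N = 0 ->
  \sum_(0 <= y < N) limit_weight y * f y =
  limit_mean (fun y => f y * \1_(`I_N) y).
Proof.
move=> bf f0; elim: N => [|N IH].
  rewrite big_nil; under eq_fun do rewrite indic_IIE ltn0 mulr0.
  rewrite -[LHS](mul0r (limit_mean \1_(~` [set 0%N]))) -limit_meanZ.
  - by congr limit_mean; apply/funext => y; rewrite mul0r.
  - exact: bnd_indic.
  - exact: indic_not00.
rewrite big_nat_recr//= IH /limit_weight; case: eqVneq => [->|N0].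
  rewrite mul0r addr0; congr limit_mean; apply/funext => y.
  by rewrite !indic_IIE; case: y => [|y]; rewrite ?f0 ?mul0r// ltnS ltn0.
have IN0 : (\1_[set N] 0%N : R) = 0 by rewrite indic1E eq_sym (negbTE N0).
have bIN := bnd_indic R [set N].
rewrite mulrC -limit_meanZ// -limit_meanD//; last 4 first.
- exact: bnd_cut.
- by rewrite f0 mul0r.
- exact: bndZ.
- by rewrite IN0 mulr0.
congr limit_mean; apply/funext => y; rewrite !indic_IIE indic1E.
rewrite [(y < N.+1)%N]leq_eqVlt eqSS.
by case: eqVneq => [->|_] /=; rewrite ?ltnn ?mulr0 ?add0r ?addr0.
Qed.

Lemma ts_tight t x e : 0 < t -> 0 < e ->
  exists N, forall M, (N <= M)%N -> T t (fun y => 1 - \1_(`I_M) y) x <= e.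
Proof.
move=> t0 e0; have [N hN] := cT x t0 e0; exists N => M NM.
have bM := bnd_indic R (`I_M).
have t0' := ltW t0; rewrite (tsB sgT)//; last exact: bnd_cst.
rewrite (ts_cst sgT)//; have := hN 1%N isT; rewrite /= divr1 => le1.
have : killed T N t (fun=> 1) x <= T t \1_(`I_M) x.
  apply: le_trans (killed_ts sgT N x (ltW t0) bM _); last first.
    by move=> y; have /andP[] := indic_itv R (`I_M) y.
  rewrite /killed; case: ifP => // _; apply: ler_sum => y _.
  by rewrite indic_IIE (leq_trans (ltn_ord y) NM).
by move: le1; lra.
Qed.

Lemma limit_weight_not0 N : \sum_(0 <= y < N) limit_weight y =
  limit_mean (fun y => \1_(~` [set 0%N]) y * \1_(`I_N) y).
Proof.
rewrite -sum_limit_weight; last 2 first.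
- exact: bnd_indic.
- exact: indic_not00.
apply: eq_bigr => y _; rewrite indic_not0 indic1E /limit_weight.
by case: eqVneq => _; rewrite ?mul0r// subr0 mulr1.
Qed.

Lemma limit_weight_sum_le N : \sum_(0 <= y < N) limit_weight y <= 1.
Proof.
have bI := bnd_indic R (~` [set 0%N]).
have I0 := indic_not00 R.
rewrite -limit_mean1 limit_weight_not0; apply: limit_mean_le => //.
- exact: bnd_cut.
- by rewrite I0 mul0r.
- move=> y; have /andP[i0 i1] := indic_itv R (~` [set 0%N]) y.
  by rewrite ler_piMr// indic_IIE lern1 leq_b1.
Qed.

(** No mass escapes to infinity: the conditional law at one large time is tight,
    and its distance to the limit is controlled uniformly over functions bounded
    by 1. *)
Lemma limit_weight_tight e : 0 < e ->
  exists N, 1 - e <= \sum_(0 <= y < N) limit_weight y.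
Proof.
move=> e0; have /cvgrPdist_le /(_ (e / 2)) := cvg_geometric0 (2 * 1) gamma_itv.
case=> [|n0 _ hn]; first by rewrite divr_gt0.
pose n := n0.+1; have n1 : (0 : R) < n%:R by rewrite ltr0n.
have nge0 := ltW n1.
have := hn n (leqnSn n0); rewrite /= sub0r normrN => ne.
have uz := survival_gt0 nge0 z0.
have [N hN] := ts_tight z n1 (mulr_gt0 (divr_gt0 e0 (ltr0n R 2)) uz).
exists N.+1; set f := fun y => 1 - (\1_(`I_N.+1) y : R).
have f0 : f 0%N = 0 by rewrite /f indic_IIE subrr.
have f1 y : `|f y| <= 1.
  rewrite /f indic_IIE; case: ltnP => _.
    by rewrite subrr normr0.
  by rewrite subr0 normr1.
have bf : bnd f by exists 1.
have [lo [hi [e1 k]]] := exists_cond_means_in nge0 f0 f1.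
have /andP[_ l2] := limit_mean_in nge0 bf k.
have /andP[] := k z; rewrite -(ler_pdivlMr _ _ uz) => r1 _.
have r2 : T n%:R f z / u n%:R z <= e / 2 by rewrite ler_pdivrMr// hN// leqnSn.
rewrite natrK in e1.
have Lf : limit_mean f <= e by have := ler_norm (2 * 1 * (1 - gamma) ^+ n); lra.
have bI := bnd_indic R (~` [set 0%N]).
have I0 := indic_not00 R.
rewrite limit_weight_not0 lerBlDr.
apply: (@le_trans _ _ (limit_mean (fun y => \1_(~` [set 0%N]) y *
  \1_(`I_(N.+1)) y) + limit_mean f)); last by rewrite lerD2l.
rewrite -limit_meanD//; last 2 first.
- exact: bnd_cut.
- by rewrite I0 mul0r.
rewrite -limit_mean1; apply: limit_mean_le => //.
- by apply: bndD => //; exact: bnd_cut.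
- by rewrite I0 mul0r f0 addr0.
move=> y; rewrite /f indic_IIE indic_not0 indic1E.
by case: ltnP => _; case: eqVneq => _ /=; lra.
Qed.

(** Finite partial sums give one inequality between the two means of a
    nonnegative function.  Off 0 it applies to both [M + f] and [M - f], and the
    weights have total mass 1, so it is an equality. *)
Lemma limit_law : exists rho : probability nat R, rho [set 0%N] = 0%E /\
  forall f, bnd f -> f 0%N = 0 -> expect rho id f = limit_mean f.
Proof.
have [|rho rhoE] := probability_of_weights limit_weight_ge0.
  apply: eseries_eq1; [exact: limit_weight_ge0|exact: limit_weight_sum_le|].
  exact: limit_weight_tight.
have rho0 : rho [set 0%N] = 0%E by rewrite rhoE /limit_weight eqxx.
exists rho; split=> //.
have mid := measurable_id_nat.
have le_L f : bnd f -> f 0%N = 0 -> (forall y, 0 <= f y) ->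
    expect rho id f <= limit_mean f.
  move=> bf f0 fpos; rewrite -lee_fin (expect_series _ mid)//.
  apply: lime_le.
    apply: is_cvg_nneseries => n _ _.
    by rewrite mule_ge0// lee_fin.
  apply: nearW => N.
  under eq_bigr do rewrite preimage_id rhoE -EFinM.
  rewrite sumEFin lee_fin sum_limit_weight//; apply: limit_mean_le => //.
  - exact: bnd_cut.
  - by rewrite f0 mul0r.
  - by move=> y; rewrite ler_piMr// indic_IIE lern1 leq_b1.
have bI := bnd_indic R (~` [set 0%N]).
have I0 := indic_not00 R.
have EI := expect_not0 rho0.
move=> f bf f0; have [M fM] := bf.
pose MI y := M * (\1_(~` [set 0%N]) y : R).
have fMI y : 0 <= MI y + f y /\ 0 <= MI y + -1 * f y.
  rewrite /MI indic_not0 indic1E; case: eqVneq => [->|_].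
    by rewrite f0 subrr !mulr0 addr0.
  by have := fM y; rewrite subr0 mulr1 ler_norml => /andP[]; lra.
have bMI : bnd MI by exact: bndZ.
have bNf : bnd (fun y => -1 * f y) by exact: bndZ.
have MI0 : MI 0%N = 0 by rewrite /MI I0 mulr0.
have := le_L (fun y => MI y + f y) (bndD bMI bf) _ (fun y => (fMI y).1).
have := le_L (fun y => MI y + -1 * f y) (bndD bMI bNf) _ (fun y => (fMI y).2).
rewrite MI0 f0 !mulr0 addr0 => /(_ erefl) + /(_ erefl).
rewrite !(expectD _ mid)// !limit_meanD//; last by rewrite f0 mulr0.
rewrite !(expectZ _ mid)// !limit_meanZ// EI limit_mean1.
by move=> h1 h2; apply/eqP; rewrite eq_le; apply/andP; split; lra.
Qed.

Lemma ts_at0 t f : 0 <= t -> bnd f -> f 0%N = 0 -> T t f 0%N = 0.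
Proof.
move=> t0 [M fM] f0; have [lo [hi [_ /(_ 0%N)]]] := exists_cond_means_in t0 f0 fM.
by rewrite (survival0 sgT p00)// !mulr0 => /le_anti.
Qed.

(** The limit of the identity
    T(n, T(t, f)) / u(n) = (T(n + t, f) / u(n + t)) * (u(n + t) / u(n)),
    which is the quasi-stationarity of the limit law. *)
Lemma limit_mean_ts t f : 0 <= t -> bnd f -> f 0%N = 0 ->
  limit_mean (T t f) = limit_mean f * limit_mean (u t).
Proof.
move=> t0 bf f0; apply: limit_meanE.
- exact: (ts_bnd sgT).
- exact: ts_at0.
have h1 := cvg_limit_mean bf f0 t0.
have h2 := cvg_limit_mean0 (survival_bnd sgT t0) (survival0 sgT p00 t0).
apply: cvg_trans (cvgM h1 h2).
apply: near_eq_cvg; near=> n.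
have nt0 : 0 <= n%:R + t by rewrite addr_ge0.
rewrite /= -(survival_add sgT)// -(ts_comp sgT)// mulrA divfK//.
by rewrite gt_eqF// survival_gt0.
Unshelve. all: by end_near. Qed.

End Doeblin.

(** * Paths with finitely many jumps are bounded *)

(** The infimum of the counterexamples is not one of them, by the last
    hypothesis, and then is not their infimum, by the second one. *)
Lemma real_induction (R : realType) (A : R -> Prop) (a b : R) :
  A a ->
  (forall x, a <= x < b -> A x ->
     exists2 e, 0 < e & forall y, x < y < x + e -> A y) ->
  (forall x, a < x <= b -> (forall y, a <= y < x -> A y) -> A x) ->
  forall x, a <= x <= b -> A x.
Proof.
move=> Aa Ar Al x0 x0ab; apply: contrapT => nAx0.
pose bad := [set x | a <= x <= b /\ ~ A x].
have bx0 : bad x0 by [].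
have bad_inf : has_inf bad.
  by split; [exists x0|exists a => x [/andP[]]].
pose c := inf bad.
have ac : a <= c by apply: lb_le_inf; [exists x0|move=> x [/andP[]]].
have cx0 : c <= x0 by apply: ge_inf => //; exact: bad_inf.2.
have /andP[ax0 x0b] := x0ab.
have Alt y : a <= y < c -> A y.
  move=> /andP[ay yc]; apply: contrapT => nAy.
  have : c <= y.
    apply: ge_inf; first exact: bad_inf.2.
    by split=> //; rewrite ay (le_trans (ltW yc))// (le_trans cx0).
  by rewrite leNgt yc.
have Ac : A c.
  move: ac; rewrite le_eqVlt => /predU1P[<-//|ac].
  by apply: Al => //; rewrite ac (le_trans cx0).
have cb : c < b.
  rewrite lt_neqAle (le_trans cx0)// andbT; apply/eqP => cb.
  by apply: nAx0; suff <- : c = x0 by []; apply/eqP; rewrite eq_le cx0 cb.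
have [|e e0 he] := Ar c _ Ac; first by rewrite ac cb.
have [x [xab nAx] xce] := inf_adherent e0 bad_inf.
have cx : c <= x by apply: ge_inf; [exact: bad_inf.2|].
move: cx; rewrite le_eqVlt => /predU1P[cx|cx]; first by apply: nAx; rewrite -cx.
by apply: nAx; apply: he; rewrite cx.
Qed.

Section Paths.
Context (R : realType) (f : R -> nat).
Hypothesis rcf : right_continuous_path f.

Lemma right_cst x : 0 <= x ->
  exists2 e, 0 < e & forall y, x < y < x + e -> f y = f x.
Proof.
move=> /rcf [e /= e0 he]; exists e => // y /andP[xy yx].
by apply: he => //=; rewrite distrC gtr0_norm ?subr_gt0// ltrBlDl.
Qed.

Lemma left_cst x : 0 < x -> ~ jump_times f x ->
  exists2 e, 0 < e & forall y, x - e < y < x -> f y = f x.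
Proof.
move=> x0 nJ; have : \forall s \near x^'-, f s = f x.
  by apply: contrapT => h; apply: nJ.
move=> [e /= e0 he]; exists e => // y /andP[xy yx].
by apply: he => //=; rewrite gtr0_norm ?subr_gt0// ltrBlDl -ltrBlDr.
Qed.

Lemma cst_between_jumps (a b : R) : 0 <= a ->
  (forall s, a < s < b -> ~ jump_times f s) ->
  forall s, a <= s < b -> f s = f a.
Proof.
move=> a0 nJ s /andP[as_ sb].
apply: (@real_induction _ (fun x => f x = f a) a s) => //; last 2 first.
- move=> x /andP[ax xs] Hx.
  have [||e e0 he] := @left_cst x.
  + exact: le_lt_trans ax.
  + by apply: nJ; rewrite ax (le_lt_trans xs).
  pose y := Num.max a (x - e / 2).
  have yx : a <= y < x by rewrite le_max lexx/= gt_max ax /= gtrBl divr_gt0.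
  rewrite -(Hx y yx); apply/esym/he; move: yx => /andP[_ ->]; rewrite andbT.
  by rewrite lt_max; apply/orP; right; lra.
- by rewrite as_ lexx.
- move=> x /andP[ax xs] fx.
  have [e e0 he] := right_cst (le_trans a0 ax).
  by exists e => // y /he ->.
Qed.

Lemma finite_gap (s : seq R) (a x : R) : a < x ->
  exists2 d, a <= d < x & forall y, y \in s -> ~ (d < y < x).
Proof.
move=> ax; elim: s => [|y s [d /andP[ad dx] hd]].
  by exists a; rewrite ?lexx.
have [yx|xy] := ltP y x.
  exists (Num.max d y); first by rewrite le_max ad/= gt_max dx.
  move=> r; rewrite in_cons gt_max => /predU1P[->|/hd rs].
    by rewrite ltxx andbF.
  by move=> /andP[/andP[dr _] rx]; apply: rs; rewrite dr.
exists d; first by rewrite ad.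
move=> r; rewrite in_cons => /predU1P[-> /andP[_]|/hd//].
by rewrite ltNge xy.
Qed.

(** Induction along [0, t].  To reach a time [x], pick an interval that ends at
    [x] and contains no jump: the path is constant on it. *)
Lemma finitely_many_jumps_bounded (t : R) :
  finite_set (jump_times f `&` [set s | s <= t]) ->
  exists N, forall s, 0 <= s <= t -> (f s < N)%N.
Proof.
move=> /finite_seqP[J JE].
have [t0|t0] := ltP t 0.
  exists 0%N => s /andP[s0 st].
  by have := le_lt_trans (le_trans s0 st) t0; rewrite ltxx.
suff : exists N, forall r, 0 <= r <= t -> (f r < N)%N by [].
apply: (@real_induction _
  (fun x => exists N, forall r, 0 <= r <= x -> (f r < N)%N) 0 t);
  last by rewrite t0 lexx.
- by exists (f 0).+1 => r /le_anti <-.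
- move=> x /andP[x0 xt] [N hN]; have [e e0 he] := right_cst x0.
  exists e => // y /andP[xy yx]; exists N => r /andP[r0 ry].
  have [rx|xr] := leP r x; first by rewrite hN// r0.
  rewrite he ?hN ?x0 ?lexx// xr; exact: le_lt_trans yx.
- move=> x /andP[x0 xt] Hx.
  have [d /andP[d0 dx] hd] := finite_gap J x0.
  pose y := (d + x) / 2.
  have [dy yx] : d < y /\ y < x by rewrite /y; split; lra.
  have y0 : 0 <= y by exact: le_trans (ltW dy).
  have [N hN] := Hx y (introT andP (conj y0 yx)).
  have cst : forall s, y <= s < x -> f s = f y.
    apply: cst_between_jumps => // s /andP[ys sx] js.
    apply: (hd s); last by rewrite sx (lt_trans dy).
    have : (jump_times f `&` [set s | s <= t]) s.
      by split=> //=; rewrite (le_trans (ltW sx)).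
    by rewrite JE.
  exists (maxn N (f x).+1) => r /andP[r0 rx]; rewrite leq_max.
  move: rx; rewrite le_eqVlt => /predU1P[->|rx]; first by rewrite leqnn orbT.
  have [ry|yr] := leP r y; first by rewrite hN// r0.
  by rewrite (cst r) ?hN ?y0 ?lexx// (ltW yr).
Qed.

End Paths.

(** * The semigroup of the process *)

Section Process.
Context (R : realType) d (Omega : measurableType d).
Context (P : nat -> probability Omega R) (X : R -> Omega -> nat).
Hypothesis hX : markov_process P X.

Definition process_semigroup (t : R) (f : nat -> R) (x : nat) : R :=
  expect (P x) (X t) f.
Local Notation T := process_semigroup.

Lemma mX t : 0 <= t -> measurable_fun setT (X t).
Proof. exact: (mp_measurable hX). Qed.

Lemma measurable_at t (B : set nat) : 0 <= t -> measurable (X t @^-1` B).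
Proof. by move=> t0; exact: (measurable_preim_nat (mX t0)). Qed.

Lemma process_trans_prob t x y : 0 <= t ->
  (trans_prob T t x y)%:E = P x (X t @^-1` [set y]).
Proof.
move=> t0; rewrite /trans_prob /process_semigroup (expect_indic _ (mX t0)).
by rewrite fineK// fin_num_measure//; exact: measurable_at.
Qed.

Lemma past_at s t (B : set nat) : 0 <= s <= t -> past X t (X s @^-1` B).
Proof. by move=> st; apply: sub_sigma_algebra; exists s, B. Qed.

Lemma past_setI t (A B : set Omega) : past X t A -> past X t B ->
  past X t (A `&` B).
Proof.
by move=> pA pB; exact: (@measurableI _ (g_sigma_algebraType _) A B pA pB).
Qed.

Lemma past_le s t (A : set Omega) : s <= t -> past X s A -> past X t A.
Proof.
move=> st; apply: sub_sigma_algebra2 => _ [u [B [/andP[u0 us] ->]]].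
by exists u, B; rewrite u0 (le_trans us).
Qed.

Lemma past_setT t : past X t setT.
Proof. exact: (@measurableT _ (g_sigma_algebraType _)). Qed.

Lemma markov_step x y z (s t : R) (A : set Omega) : 0 <= s -> 0 <= t ->
  past X s A ->
  P x (A `&` X s @^-1` [set y] `&` X (s + t) @^-1` [set z]) =
  (P x (A `&` X s @^-1` [set y]) * (trans_prob T t y z)%:E)%E.
Proof.
by move=> s0 t0 pA; rewrite (mp_markov hX)// process_trans_prob.
Qed.

Lemma chapman_kolmogorov x z s t : 0 <= s -> 0 <= t ->
  (\sum_(0 <= y <oo) P x (X s @^-1` [set y]) * (trans_prob T t y z)%:E)%E =
  P x (X (s + t) @^-1` [set z]).
Proof.
move=> s0 t0.
have pT : past X s setT by exact: past_setT.
transitivity (\sum_(0 <= y <oo)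
    P x (X s @^-1` [set y] `&` X (s + t) @^-1` [set z]))%E.
  apply: eq_eseriesr => y _.
  by have := markov_step x y z s0 t0 pT; rewrite !setTI.
rewrite -(measure_semi_bigcup (P x)).
- congr (P x _); apply/seteqP; split => [w [y _ [_ wz]]//|w wz].
  by exists (X s w).
- by move=> y; apply: measurableI; apply: measurable_at => //; exact: addr_ge0.
- by move=> i j _ _ [w [[/= <- _] [/= <- _]]].
- apply: bigcup_measurable => y _.
  by apply: measurableI; apply: measurable_at => //; exact: addr_ge0.
Qed.

Lemma process_bnd t f : 0 <= t -> bnd f -> bnd (T t f).
Proof.
move=> t0 [M fM]; exists M => x.
have fMx y : - M <= f y <= M by rewrite -ler_norml.
have bf := bnd_le fMx.
rewrite ler_norml -[X in X <= _ <= _](expect_cst (P x) (X t)).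
rewrite -[X in _ <= _ <= X](expect_cst (P x) (X t)).
by rewrite !(expect_le (P x) (mX t0))//; try exact: bnd_cst;
  move=> y; have /andP[] := fMx y.
Qed.

Lemma process_comp_ge0 s t f x : 0 <= s -> 0 <= t -> bnd f ->
  (forall y, 0 <= f y) -> T (s + t) f x = T s (T t f) x.
Proof.
move=> s0 t0 bf f0; have st0 : 0 <= s + t by exact: addr_ge0.
have Tf0 y : 0 <= T t f y by exact: expect_ge0.
apply: EFin_inj.
rewrite /process_semigroup (expect_series _ (mX st0))//.
rewrite (expect_series _ (mX s0))//; last exact: process_bnd.
have pge0 u y z : (0 <= P u (X s @^-1` [set y]) * (trans_prob T t y z)%:E)%E.
  by rewrite mule_ge0// process_trans_prob.
transitivity (\sum_(0 <= z <oo) \sum_(0 <= y <oo)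
    (P x (X s @^-1` [set y]) * (trans_prob T t y z)%:E * (f z)%:E))%E.
  apply: eq_eseriesr => z _; rewrite -chapman_kolmogorov// muleC.
  rewrite -nneseriesZl; last by move=> y _; exact: pge0.
  by apply: eq_eseriesr => y _; rewrite muleC.
rewrite nneseries_interchange; last first.
  by move=> z y; rewrite mule_ge0// lee_fin.
apply: eq_eseriesr => y _.
rewrite (expect_series _ (mX t0))//.
have fin : P x (X s @^-1` [set y]) \is a fin_num.
  by rewrite fin_num_measure//; exact: measurable_at.
rewrite -(fineK fin) -nneseriesZl; last first.
  by move=> z _; rewrite mule_ge0// lee_fin.
by apply: eq_eseriesr => z _; rewrite muleA process_trans_prob.
Qed.

Lemma start_elsewhere x : P x (X 0 @^-1` (~` [set x])) = 0%E.
Proof.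
rewrite -preimage_setC probability_setC; last exact: measurable_at.
by rewrite (mp_start hX) subee.
Qed.

(** The process starts at [x] only almost surely; [f] differs from [f x] by at
    most [2 * M] off [x]. *)
Lemma process_start f x : bnd f -> T 0 f x = f x.
Proof.
move=> bf; have m0 := mX (lexx 0); have [M fM] := bf.
have not_x : expect (P x) (X 0) (\1_(~` [set x])) = 0.
  by rewrite (expect_indic _ m0) start_elsewhere.
have bI := bnd_indic R (~` [set x]).
have bg : bnd (fun y => f y + - f x) by apply: bndD => //; exact: bnd_cst.
rewrite -[T 0 f x](addrK (expect (P x) (X 0) (fun=> - f x))).
rewrite -(expectD _ m0)//; last exact: bnd_cst.
rewrite expect_cst opprK -[RHS]add0r; congr (_ + _).
have bound y : - (2 * M) * \1_(~` [set x]) y <= f y + - f x <=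
               2 * M * \1_(~` [set x]) y.
  rewrite indicE in_setC in_set1; case: eqVneq => [->|_] /=.
    by rewrite subrr !mulr0 lexx.
  have := fM x; have := fM y; rewrite !ler_norml !mulr1.
  by move=> /andP[a1 a2] /andP[a3 a4]; apply/andP; split; lra.
have h1 := expect_le (P x) m0 (bndZ (- (2 * M)) bI) bg
  (fun y => proj1 (andP (bound y))).
have h2 := expect_le (P x) m0 bg (bndZ (2 * M) bI)
  (fun y => proj2 (andP (bound y))).
move: h1 h2; rewrite !(expectZ _ m0)// not_x !mulr0 => h1 h2.
by apply/eqP; rewrite eq_le h2 h1.
Qed.

Lemma process_transition_semigroup : transition_semigroup T.
Proof.
split.
- by move=> t f g x t0 bf bg; exact: (expectD _ (mX t0)).
- by move=> t c f x t0 bf; exact: (expectZ _ (mX t0)).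
- by move=> t c x t0; exact: expect_cst.
- by move=> t f x t0 _ f0; exact: expect_ge0.
- exact: process_start.
move=> s t f x s0 t0 bf; have [M fM] := bf.
have bc := bnd_cst M.
have fM0 y : 0 <= f y + M.
  by have := fM y; rewrite ler_norml => /andP[]; lra.
have st0 : 0 <= s + t by exact: addr_ge0.
have := process_comp_ge0 x s0 t0 (bndD bf bc) fM0.
have -> : T t (fun y => f y + M) = (fun y => T t f y + M).
  apply/funext => y; rewrite /process_semigroup (expectD _ (mX t0))//.
  by rewrite expect_cst.
rewrite /process_semigroup !(expectD _ (mX _))//; last exact: process_bnd.
by rewrite !expect_cst => /addIr.
Qed.

(** Recursive in the number of steps, so that each step adds one event of the
    past to which the Markov property applies. *)
Fixpoint stays (N : nat) (h : R) (n : nat) : set Omega :=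
  if n is m.+1 then stays N h m `&` X (n%:R * h) @^-1` `I_N
  else X 0 @^-1` `I_N.

Lemma past_stays N h n : 0 <= h -> past X (n%:R * h) (stays N h n).
Proof.
move=> h0; elim: n => [|n IH] /=.
  by rewrite mul0r; apply: past_at; rewrite lexx.
have nh0 : 0 <= n.+1%:R * h by rewrite mulr_ge0.
apply: past_setI; last by apply: past_at; rewrite nh0 lexx.
by apply: past_le IH; rewrite ler_wpM2r// ler_nat.
Qed.

Lemma measurable_stays N h n : 0 <= h -> measurable (stays N h n).
Proof.
move=> h0; elim: n => [|n IH]; first exact: measurable_at.
by apply: measurableI => //; apply: measurable_at; rewrite mulr_ge0.
Qed.

Lemma stays_sub N h n : stays N h n `<=` X (n%:R * h) @^-1` `I_N.
Proof. by case: n => [|n]; [rewrite mul0r|move=> w []]. Qed.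

Lemma stays_split N h n x (B : set Omega) : 0 <= h -> measurable B ->
  fine (P x (stays N h n `&` B)) =
  \sum_(y < N)
    fine (P x (stays N h n `&` X (n%:R * h) @^-1` [set (y : nat)] `&` B)).
Proof.
move=> h0 mB; have nh0 : 0 <= n%:R * h by rewrite mulr_ge0.
pose F y := stays N h n `&` X (n%:R * h) @^-1` [set y] `&` B.
have mF y : measurable (F y).
  apply: measurableI => //; apply: measurableI; first exact: measurable_stays.
  exact: measurable_at.
rewrite sum_fine; last by move=> y _; apply: fin_num_measure; exact: (mF y).
rewrite -(measure_bigsetU (P x) mF); last first.
  by move=> i j _ _ [w [[[_ /= <-] _] [[_ /= <-] _]]].
congr (fine (P x _)); rewrite -(bigcup_mkord N F); apply/seteqP; split => w.
  move=> [Sw Bw]; exists (X (n%:R * h) w) => //.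
  exact: (stays_sub Sw).
by move=> [y _ [[]]].
Qed.

(** The killed iterates are finite-dimensional probabilities of the process.
    The Markov property adds steps at the end of the path, hence the induction
    unfolds the iterate from the inside. *)
Lemma stays_killed N h n x f : 0 <= h -> (x < N)%N ->
  iter n (killed T N h) f x =
  \sum_(y < N)
    fine (P x (stays N h n `&` X (n%:R * h) @^-1` [set (y : nat)])) * f y.
Proof.
move=> h0 xN; elim: n f => [|n IH] f.
  rewrite (bigD1 (Ordinal xN))//= mul0r big1 ?addr0.
    rewrite (_ : _ `&` _ = X 0 @^-1` [set x]) ?(mp_start hX) ?mul1r//.
    by apply/seteqP; split => [w []//|w /= wx]; split=> //=; rewrite wx.
  move=> y yx.
  suff -> : P x (X 0 @^-1` `I_N `&` X 0 @^-1` [set (y : nat)]) = 0%E.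
    by rewrite mul0r.
  apply: (@subset_measure0 _ _ _ _ _ (X 0 @^-1` (~` [set x]))).
  - by apply: measurableI; exact: measurable_at.
  - exact: measurable_at.
  - by move=> w [_ /= ->] yx'; move: yx; rewrite -val_eqE /= yx' eqxx.
  - exact: start_elsewhere.
rewrite iterSr IH.
have nh0 : 0 <= n%:R * h by rewrite mulr_ge0.
have nE : n.+1%:R * h = n%:R * h + h by rewrite -addn1 natrD mulrDl mul1r.
under eq_bigr => y _ do rewrite /killed ltn_ord mulr_sumr.
rewrite exchange_big/=; apply: eq_bigr => z _.
have -> : stays N h n `&` X (n.+1%:R * h) @^-1` `I_N `&`
    X (n.+1%:R * h) @^-1` [set (z : nat)] =
    stays N h n `&` X (n.+1%:R * h) @^-1` [set (z : nat)].
  apply/seteqP; split => [w [[]]//|w [Sw /= wz]].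
  by do 2 split=> //=; rewrite wz.
rewrite stays_split//; last by apply: measurable_at; rewrite mulr_ge0.
rewrite mulr_suml; apply: eq_bigr => y _; rewrite mulrA; congr (_ * _).
rewrite nE (markov_step x y z nh0 h0 (past_stays N (n := n) h0)) fineM//.
rewrite fin_num_measure//; apply: measurableI; first exact: measurable_stays.
exact: measurable_at.
Qed.

Lemma stays_prob N h n x : 0 <= h -> (x < N)%N ->
  iter n (killed T N h) (fun=> 1) x = fine (P x (stays N h n)).
Proof.
move=> h0 xN; rewrite stays_killed// -[stays N h n in RHS]setIT stays_split//.
by apply: eq_bigr => y _; rewrite mulr1 setIT.
Qed.

Lemma staysP N h n w : stays N h n w <->
  forall j, (j <= n)%N -> (X (j%:R * h) w < N)%N.
Proof.
elim: n => [|n IH]; split.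
- by move=> w0 j; rewrite leqn0 => /eqP ->; rewrite mul0r.
- by move=> /(_ 0%N isT); rewrite mul0r.
- move=> [/IH H wN] j; rewrite leq_eqVlt => /predU1P[->//|]; exact: H.
- by move=> H; split; [apply/IH => j /leqW/H|exact: H].
Qed.

Hypothesis hnonexpl : nonexplosive P X.

(** Without explosion almost every path is bounded on [0, t].  Hence the events
    of staying below [N] at all times [j * t / n], [j <= n], increase with [N] to
    an event of probability 1, and each is contained in the events for one
    [n]. *)
Lemma process_confined : confined T.
Proof.
move=> x t eta t0 eta0.
pose G N : set Omega := \bigcap_n stays N (t / n.+1%:R) n.+1.
have h0 n : 0 <= t / n.+1%:R by rewrite divr_ge0// ltW.
have mG N : measurable (G N).
  by apply: bigcapT_measurable => n; exact: measurable_stays.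
have mGU : measurable (\bigcup_N G N) by exact: bigcupT_measurable.
have ndG : {homo G : n m / (n <= m)%N >-> (n <= m)%O}.
  move=> n m nm; apply/subsetPset => w Gw k _; apply/staysP => j jk.
  by apply: leq_trans nm; move: j jk; apply/staysP; exact: Gw.
have PG : P x (\bigcup_N G N) = 1%E.
  have : (P x).-negligible (~` \bigcup_N G N).
    apply: negligibleS (hnonexpl x) => w /= nGw H; apply: nGw.
    have [N hN] := finitely_many_jumps_bounded (mp_right_continuous hX w) (H t).
    exists N => // n _; apply/staysP => j jn; apply: hN.
    rewrite mulr_ge0//= mulrCA ger_pMr// ler_pdivrMr ?ltr0n// mul1r ler_nat.
    exact: jn.
  move=> /(negligibleP _ (measurableC mGU)) nG.
  rewrite -[\bigcup_N G N]setCK probability_setC; last exact: measurableC.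
  by rewrite [X in (_ - X)%E](_ : _ = 0%E) ?sube0.
have : (P x \o G) n @[n --> \oo] --> 1%E.
  by rewrite -PG; exact: nondecreasing_cvg_mu.
move=> /fine_cvg cG.
have : \forall n \near \oo, 1 - eta <= fine (P x (G n)).
  move/cvgrPdist_le : cG => /(_ eta eta0); apply: filterS => n /=.
  by rewrite ler_norml => /andP[_]; lra.
move=> [N0 _ hN0]; pose N := maxn N0 x.+1; exists N => -[//|n] _.
rewrite stays_prob//; last by rewrite leq_max ltnSn orbT.
apply: le_trans (hN0 N _) _; first by rewrite /= leq_max leqnn.
apply: fine_le; rewrite ?fin_num_measure//; try exact: measurable_stays.
apply: le_measure; rewrite ?inE//; first exact: measurable_stays.
by move=> w; exact.
Qed.

End Process.

(** * Conditioned laws *)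

Section Absorption.
Context (R : realType) d (Omega : measurableType d).
Context (P : nat -> probability Omega R) (X : R -> Omega -> nat).
Hypothesis hX : markov_process P X.
Hypothesis habs : zero_absorbing X.
Local Notation T := (process_semigroup P X).

Lemma T0_le s w : 0 <= s -> X s w = 0%N -> (T0 X w <= s%:E)%E.
Proof. by move=> s0 Xs; apply: ereal_inf_lbound; exists s. Qed.

Lemma alive_set t : 0 <= t ->
  [set w | (t%:E < T0 X w)%E] = X t @^-1` (~` [set 0%N]).
Proof.
move=> t0; apply/seteqP; split => w /=.
  by move=> tT Xt; move: tT; rewrite ltNge T0_le.
by move=> Xt; rewrite ltNge; apply/negP => /(habs t0).
Qed.

Lemma absorbed_stays t : 0 <= t -> trans_prob T t 0 0 = 1.
Proof.
move=> t0; apply: EFin_inj; rewrite (process_trans_prob hX)//.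
have mt := measurable_at hX [set 0%N] t0.
apply/eqP; rewrite eq_le (probability_le1 _ mt)/=.
rewrite -[X in (X <= _)%E](mp_start hX 0%N); apply: le_measure.
- by rewrite inE; exact: (measurable_at hX).
- by rewrite inE; exact: (measurable_at hX).
move=> w X0; apply: habs => //.
by apply: le_trans (T0_le (lexx 0) X0) _; rewrite lee_fin.
Qed.

Lemma initial_lawE (mu : probability nat R) t (B : set nat) : 0 <= t ->
  initial_law P mu (X t @^-1` B) = (expect mu id (T t \1_B))%:E.
Proof.
move=> t0; have bB := process_bnd hX t0 (bnd_indic R B).
rewrite (expect_series _ measurable_id_nat)//; last first.
  by move=> y; apply: expect_ge0 => z; have /andP[] := indic_itv R B z.
apply: eq_eseriesr => x _; rewrite preimage_id; congr (_ * _)%E.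
rewrite /process_semigroup (expect_indic _ (mX hX t0)) fineK//.
by rewrite fin_num_measure//; exact: (measurable_at hX).
Qed.

Lemma conditioned_lawE (mu : probability nat R) t (B : set nat) : 0 <= t ->
  conditioned_law P X mu t B =
  expect mu id (T t \1_(B `\` [set 0%N])) / expect mu id (survival T t).
Proof.
move=> t0; rewrite /conditioned_law alive_set// -preimage_setI -setDE.
by rewrite !initial_lawE.
Qed.

End Absorption.

Section Convergence.
Context (R : realType) (T : R -> (nat -> R) -> nat -> R).
Hypothesis sgT : transition_semigroup T.
Variable g : R.
Variable rho : probability nat R.
Hypothesis survival_lb : forall t, 0 <= t -> exists2 d, 0 < d &
  forall x, (0 < x)%N -> d <= survival T t x.
Hypothesis bracket : forall t f (M : R), 0 <= t -> f 0%N = 0 ->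
  (forall x, `|f x| <= M) -> exists lo hi,
  [/\ hi - lo = 2 * M * (1 - g) ^+ Num.truncn t,
      cond_means_in T lo hi t f & lo <= expect rho id f <= hi].

Lemma expect_survival_gt0 (mu : probability nat R) t :
  mu [set 0%N] = 0%E -> 0 <= t -> 0 < expect mu id (survival T t).
Proof.
move=> mu0 t0; have [d d0 hd] := survival_lb t0.
apply: lt_le_trans d0 _.
rewrite -[d]mulr1 -(expect_not0 mu0) -(expectZ _ measurable_id_nat);
  last exact: bnd_indic.
apply: (expect_le _ measurable_id_nat).
- exact/bndZ/bnd_indic.
- exact: (survival_bnd sgT).
move=> [|x]; rewrite indic_not0 indic1E.
  by rewrite eqxx subrr mulr0; have /andP[] := survival_itv sgT 0%N t0.
by rewrite subr0 mulr1 hd.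
Qed.

(** An initial law averages the conditional means from its atoms, so its own
    conditional mean lies in the same bracket as theirs. *)
Lemma conditioned_mean_dist (mu : probability nat R) t f (M : R) :
  mu [set 0%N] = 0%E -> 0 <= t -> f 0%N = 0 -> (forall x, `|f x| <= M) ->
  `|expect mu id (T t f) / expect mu id (survival T t) - expect rho id f| <=
  2 * M * (1 - g) ^+ Num.truncn t.
Proof.
move=> mu0 t0 f0 fM; have bf : bnd f by exists M.
have [lo [hi [<- k /andP[l1 l2]]]] := bracket t0 f0 fM.
have Eu := expect_survival_gt0 mu0 t0.
have bu := survival_bnd sgT t0.
have bT := ts_bnd sgT t0 bf.
have h1 : lo <= expect mu id (T t f) / expect mu id (survival T t).
  rewrite ler_pdivlMr// -(expectZ _ measurable_id_nat)//.
  apply: (expect_le _ measurable_id_nat) => //; first exact: bndZ.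
  by move=> x; have /andP[] := k x.
have h2 : expect mu id (T t f) / expect mu id (survival T t) <= hi.
  rewrite ler_pdivrMr// -(expectZ _ measurable_id_nat)//.
  apply: (expect_le _ measurable_id_nat) => //; first exact: bndZ.
  by move=> x; have /andP[] := k x.
by rewrite ler_norml; apply/andP; split; lra.
Qed.

(** A finite part of the total variation is the difference of two means of the
    sign of the difference of the laws, cut off beyond [N]. *)
Lemma conditioned_tv_sum (mu : probability nat R) t N :
  mu [set 0%N] = 0%E -> 0 <= t ->
  \sum_(1 <= x < N) `|expect mu id (T t \1_[set x]) / expect mu id (survival T t)
                      - expect rho id \1_[set x]| <=
  2 * (1 - g) ^+ Num.truncn t.
Proof.
move=> mu0 t0.
pose D x := expect mu id (T t \1_[set x]) / expect mu id (survival T t)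
            - expect rho id \1_[set x].
pose f y := \sum_(1 <= x < N) Num.sg (D x) * (\1_[set x] y : R).
have bS (x : nat) : bnd (fun y => Num.sg (D x) * (\1_[set x] y : R)).
  exact/bndZ/bnd_indic.
have fE y : f y = if (1 <= y < N)%N then Num.sg (D y) else 0.
  rewrite /f; under eq_bigr do rewrite indic1E.
  case: ifP => yN.
    rewrite (bigD1_seq y) ?mem_index_iota ?iota_uniq//= eqxx mulr1.
    by rewrite big1 ?addr0// => x xy; rewrite eq_sym (negbTE xy) mulr0.
  rewrite big_seq big1// => x; rewrite mem_index_iota.
  by case: eqVneq => [<-|]; rewrite ?yN// mulr0.
have f0 : f 0%N = 0 by rewrite fE.
have f1 y : `|f y| <= 1.
  rewrite fE; case: ifP => _; last by rewrite normr0.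
  by rewrite normr_sg; case: (_ != 0).
have := conditioned_mean_dist mu0 t0 f0 f1; rewrite mulr1.
apply: le_trans; apply: le_trans (ler_norm _).
have -> : T t f = fun y => \sum_(1 <= x < N) Num.sg (D x) * T t \1_[set x] y.
  apply/funext => y; rewrite /f (ts_sum sgT)//; apply: eq_bigr => x _.
  by rewrite (tsZ sgT)//; exact: bnd_indic.
have bT (x : nat) : bnd (T t \1_[set x]).
  by apply: (ts_bnd sgT) => //; exact: bnd_indic.
rewrite (expect_sum _ _ measurable_id_nat); last by move=> x; exact: bndZ.
rewrite /f (expect_sum _ _ measurable_id_nat)// mulr_suml -sumrB.
apply: ler_sum => x _; rewrite (expectZ _ measurable_id_nat)//.
rewrite (expectZ _ measurable_id_nat); last exact: bnd_indic.
by rewrite -/(D x) normrEsg -mulrA -mulrBr.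
Qed.

End Convergence.

(** * Rates and the conclusion *)

Section RateBounds.
Context (R : realType) d (Omega : measurableType d).
Context (P : nat -> probability Omega R) (X : R -> Omega -> nat).
Context (Q : nat -> nat -> R) (K : {fset nat}).
Hypothesis hX : markov_process P X.
Hypothesis hQ : stable_with_rates P X Q.
Hypothesis gap :
  (ereal_sup [set (Q y 0%N)%:E | y in [set y : nat | (0 < y)%N]] <
   ereal_inf [set (Q y 0%N + \sum_(x <- K) Q y x)%:E
             | y in [set y : nat | (0 < y)%N && (y \notin K)]])%E.
Local Notation T := (process_semigroup P X).

Lemma transitionE t x y : 0 <= t -> transition P X t x y = trans_prob T t x y.
Proof. by move=> t0; rewrite /transition -(process_trans_prob hX). Qed.

Lemma rate_cvg x y : x != y -> trans_prob T h x y / h @[h --> 0^'+] --> Q x y.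
Proof.
move=> xy; apply: cvg_trans (hQ (x := x) (y := y)); apply: near_eq_cvg.
move: (nbhs_right_gt (0 : R)); apply: filterS => h h0.
by rewrite (negbTE xy) subr0 transitionE// ltW.
Qed.

Lemma rate_ge0 x y : x != y -> 0 <= Q x y.
Proof.
move=> xy; rewrite leNgt; apply/negP => Q0.
have [e e0 he] := near_right0 (cvgr_lt _ (rate_cvg xy) _ Q0).
have e20 : 0 < e / 2 by rewrite divr_gt0.
have /he : 0 < e / 2 < e by rewrite e20; lra.
rewrite ltNge divr_ge0// ?(ltW e20)//.
exact: (trans_prob_ge0 (process_transition_semigroup hX)) (ltW e20).
Qed.

Lemma near_kill_rate (a : R) y : (0 < y)%N -> Q y 0 < a ->
  \forall h \near 0^'+, trans_prob T h y 0 <= h * a.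
Proof.
move=> y0 Qa; have y0' : y != 0%N by rewrite gtn_eqF.
have near_a : \forall h \near (0 : R)^'+, trans_prob T h y 0 / h < a.
  exact: cvgr_lt _ (rate_cvg y0') _ Qa.
move: near_a (nbhs_right_gt (0 : R)).
apply: filterS2 => h ph h0; apply: ltW.
by move: ph; rewrite ltr_pdivrMr// mulrC.
Qed.

Lemma near_return_rate (b : R) y : (0 < y)%N -> y \notin K ->
  b < Q y 0 + \sum_(k <- K) Q y k ->
  \forall h \near 0^'+,
    h * b <= trans_prob T h y 0 + \sum_(k <- K) trans_prob T h y k.
Proof.
move=> y0 yK bQ; have y0' : y != 0%N by rewrite gtn_eqF.
have cK : \sum_(k <- K | k \in K) (trans_prob T h y k / h) @[h --> 0^'+] -->
          \sum_(k <- K | k \in K) Q y k.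
  apply: cvg_big => [|k kK]; first exact: add_continuous.
  apply: rate_cvg.
  by apply: contraNneq yK => ->.
rewrite big_seq in bQ.
have near_b : \forall h \near (0 : R)^'+, b < trans_prob T h y 0 / h +
    \sum_(k <- K | k \in K) (trans_prob T h y k / h).
  exact: cvgr_gt _ (cvgD (rate_cvg y0') cK) _ bQ.
move: near_b (nbhs_right_gt (0 : R)); apply: filterS2 => h ph h0.
move: ph; rewrite -big_seq -mulr_suml -mulrDl => ph; apply: ltW.
by move: ph; rewrite ltr_pdivlMr// mulrC.
Qed.

(** Multiplying the convergence to the finite rate [Q z z] by [h] shows that
    [transition P X h z z] tends to 1. *)
Lemma near_holding z : \forall h \near 0^'+, 2^-1 <= trans_prob T h z z.
Proof.
have c1 : (transition P X h z z - (z == z)%:R) / h * h @[h --> 0^'+] -->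
    Q z z * 0.
  apply: cvgM; first exact: hQ.
  exact: cvg_at_right_filter.
have m1 : -2^-1 < Q z z * 0 :> R by rewrite mulr0 oppr_lt0 invr_gt0.
have near_1 : \forall h \near (0 : R)^'+,
    - 2^-1 < (transition P X h z z - (z == z)%:R) / h * h.
  exact: cvgr_gt _ c1 _ m1.
move: near_1 (nbhs_right_gt (0 : R)).
apply: filterS2 => h ph h0; move: ph.
rewrite eqxx divfK; last by rewrite gt_eqF.
by rewrite transitionE ?(ltW h0)//=; lra.
Qed.

Lemma gap_nonempty : exists z, z \in K.
Proof.
have [K0|[z zK]] := fset_0Vmem K; last by exists z.
have : (ereal_sup [set (Q y 0%N)%:E | y in [set y : nat | (0 < y)%N]] <
        (Q 1%N 0%N)%:E)%E.
  apply: lt_le_trans gap _; apply: ereal_inf_lbound; exists 1%N.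
    by rewrite /= K0 in_fset0.
  by rewrite K0 big_seq_fset0 addr0.
by rewrite ltNge ereal_sup_ubound//; exists 1%N.
Qed.

(** Both bounds of the gap are finite: [K] is finite, hence some state of N* lies
    outside it and bounds the infimum. *)
Lemma separating_rates : exists a b, [/\ 0 < a, a < b,
  forall y, (0 < y)%N -> Q y 0%N < a &
  forall y, (0 < y)%N -> y \notin K -> b < Q y 0%N + \sum_(x <- K) Q y x].
Proof.
move: gap; set s := ereal_sup _; set i := ereal_inf _ => si.
have s_ge y : (0 < y)%N -> ((Q y 0%N)%:E <= s)%E.
  by move=> y0; apply: ereal_sup_ubound; exists y.
have i_le y : (0 < y)%N -> y \notin K ->
    (i <= (Q y 0%N + \sum_(x <- K) Q y x)%:E)%E.
  by move=> y0 yK; apply: ereal_inf_lbound; exists y => //=; rewrite y0.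
pose y1 := (\max_(x <- K) x).+1.
have y1K : y1 \notin K.
  apply/negP => y1K; suff : (y1 <= \max_(x <- K) x)%N by rewrite ltnn.
  exact: (leq_bigmax_seq (F := id)).
have sfin : s \is a fin_num.
  rewrite fin_numE; apply/andP; split; apply/eqP => sE.
    by have := s_ge 1%N isT; rewrite sE leeNy_eq.
  by move: si; rewrite sE ltNge leey.
have ifin : i \is a fin_num.
  rewrite fin_numE; apply/andP; split; apply/eqP => iE.
    by move: si; rewrite iE ltNge leNye.
  by have := i_le y1 isT y1K; rewrite iE leye_eq.
move: si s_ge i_le; rewrite -(fineK sfin) -(fineK ifin) lte_fin.
move: (fine s) (fine i) => r r' rr' s_ge i_le.
have r0 : 0 <= r.
  apply: le_trans (rate_ge0 (_ : 1%N != 0%N)) _ => //.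
  by have := s_ge 1%N isT; rewrite lee_fin.
exists ((2 * r + r') / 3), ((r + 2 * r') / 3); split; [lra|lra| |].
  by move=> y y0; have := s_ge y y0; rewrite lee_fin; lra.
by move=> y y0 yK; have := i_le y y0 yK; rewrite lee_fin; lra.
Qed.

End RateBounds.

Theorem theorem3 (R : realType) (d : measure_display)
    (Omega : measurableType d) (P : nat -> probability Omega R)
    (X : R -> Omega -> nat) (Q : nat -> nat -> R) (K : {fset nat})
    (hX : markov_process P X)
    (hnonexpl : nonexplosive P X)
    (hQ : stable_with_rates P X Q)
    (hcons : conservative_on_Nstar Q)
    (habs : zero_absorbing X)
    (hT0 : forall x : nat, P x [set w | (T0 X w < +oo)%E] = 1%E)
    (hK : 0%N \notin K)
    (hinfsup :
      (ereal_sup [set (Q y 0%N)%:E | y in [set y : nat | (0 < y)%N]] <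
       ereal_inf [set (Q y 0%N + \sum_(x <- K) Q y x)%:E
                 | y in [set y : nat | (0 < y)%N && (y \notin K)]])%E)
    (hpos : forall (x y : nat) (t : R), x \in K -> y \in K -> 0 < t ->
      0 < transition P X t x y) :
  exists (gamma : R) (rho : probability nat R),
    [/\ 0 < gamma < 1,
        rho [set 0%N] = 0%E,
        forall (mu : probability nat R) (t : R),
          mu [set 0%N] = 0%E -> 0 <= t ->
          (tv_norm (fun B => (conditioned_law P X mu t B - fine (rho B))%R) <=
           (2 * (1 - gamma) ^+ Num.truncn t)%:E)%E
      & quasi_stationary P X rho /\
        forall rho' : probability nat R, quasi_stationary P X rho' ->
          forall B : set nat, rho' B = rho B].
Proof.
pose T := process_semigroup P X.
have sgT : transition_semigroup T := process_transition_semigroup hX.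
have cT : confined T := process_confined hX hnonexpl.
have p00 : forall t, 0 <= t -> trans_prob T t 0 0 = 1 := absorbed_stays hX habs.
have [z zK] := gap_nonempty hinfsup.
have [a [b [a0 ab kill ret]]] := separating_rates hX hQ hinfsup.
have kill' y y0 := near_kill_rate hX hQ y0 (kill y y0).
have ret' y y0 yK := near_return_rate hX hQ y0 yK (ret y y0 yK).
have hold := near_holding hX hQ z.
have pos : forall x y t, x \in K -> y \in K -> 0 < t -> 0 < trans_prob T t x y.
  by move=> x y t xK yK t0; rewrite -transitionE ?(ltW t0)//; exact: hpos.
have uK := fset_uniq K.
have [c c01 minor] := minorization sgT cT uK hK a0 ab kill' ret' zK pos hold.
have [C C1 cmp] := survival_compare sgT cT p00 uK hK a0 ab kill' ret' zK pos.
have z0 : (0 < z)%N := K_gt0 hK zK.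
pose g := c / (2 * C).
have g01 : 0 < g < 1 := gamma_itv c01 C1.
have [rho [rho0 rhoE]] := limit_law sgT cT p00 z0 c01 minor C1 cmp.
exists g, rho.
have lb := survival_lower_bound sgT p00 z0 c01 minor.
have bracket : forall t f (M : R), 0 <= t -> f 0%N = 0 ->
    (forall x, `|f x| <= M) -> exists lo hi,
    [/\ hi - lo = 2 * M * (1 - g) ^+ Num.truncn t,
      cond_means_in T lo hi t f & lo <= expect rho id f <= hi].
  move=> t f M t0 f0 fM; have bf : bnd f by exists M.
  have [lo [hi [e k]]] :=
    exists_cond_means_in sgT p00 z0 c01 minor C1 cmp t0 f0 fM.
  exists lo, hi; split=> //; rewrite rhoE//.
  exact: (limit_mean_in sgT p00 z0 c01 minor t0 bf k).
have f0 (B : set nat) : (\1_(B `\` [set 0%N]) 0%N : R) = 0.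
  rewrite indicE memNset// => -[_]; exact.
have condE (mu : probability nat R) t B : 0 <= t -> conditioned_law P X mu t B =
    expect mu id (T t \1_(B `\` [set 0%N])) / expect mu id (survival T t).
  exact: conditioned_lawE.
have rho_indic (B : set nat) : rho B = (expect rho id \1_(B `\` [set 0%N]))%:E.
  rewrite (expect_indic _ measurable_id_nat) preimage_id probabilityD0//.
  by rewrite fineK// fin_num_measure//; exact: I.
split=> //.
- move=> mu t mu0 t0; rewrite /tv_norm; apply: lime_le.
    by apply: is_cvg_nneseries => n _ _; rewrite lee_fin.
  apply: nearW => N; rewrite sumEFin lee_fin.
  apply: le_trans (conditioned_tv_sum sgT lb bracket N mu0 t0).
  rewrite !big_nat; apply: ler_sum => x /andP[x0 _].
  rewrite condE// rho_indic /= (_ : [set x] `\` [set 0%N] = [set x])//.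
  apply/seteqP; split => y /= => [[]//|->]; split=> // x0'.
  by move: x0; rewrite x0'.
- split.
    split=> // t B t0; rewrite rho_indic condE//.
    set f := (\1_(B `\` [set 0%N]) : nat -> R).
    have bf : bnd f by exact: bnd_indic.
    have u0 : survival T t 0 = 0 by exact: (survival0 sgT p00).
    have bu := survival_bnd sgT t0.
    have Eu := expect_survival_gt0 sgT lb rho0 t0.
    have T0' : T t f 0%N = 0.
      exact: (ts_at0 sgT p00 z0 c01 minor C1 cmp t0 bf (f0 B)).
    rewrite (rhoE (T t f))//; last exact: (ts_bnd sgT).
    rewrite (limit_mean_ts sgT p00 z0 c01 minor C1 cmp t0 bf (f0 B)).
    by rewrite -(rhoE f bf (f0 B)) -(rhoE _ bu u0) mulfK// gt_eqF.
move=> rho' [rho'0 qsd] B.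
rewrite rho_indic.
have f1 x : `|(\1_(B `\` [set 0%N]) x : R)| <= 1.
  by have /andP[i0 i1] := indic_itv R (B `\` [set 0%N]) x; rewrite ger0_norm.
have dist n : `|fine (rho' B) - expect rho id \1_(B `\` [set 0%N])| <=
    2 * (1 - g) ^+ n.
  rewrite (qsd n%:R B)// condE//=.
  have := conditioned_mean_dist sgT lb bracket rho'0 (ler0n R n) (f0 B) f1.
  by rewrite natrK mulr1.
have eqE : fine (rho' B) = expect rho id \1_(B `\` [set 0%N]).
  apply/eqP; rewrite -subr_eq0 -normr_le0.
  apply: (cvgr_to_ge (cvg_geometric0 2 g01)).
  by apply: nearW => n; exact: dist.
by rewrite -eqE fineK// fin_num_measure.
Qed.
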